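(* Let $m,n\in\mathbb N$ and $f\in\mathbb Z^{m+n}_+$. Then (1) $\mathcal U_f=\sum_{\theta\in\{0,1\}^m}q^{|\theta|}\mathcal K_{\mathbb L_\theta(f)}$; (2) $\mathcal K_f=\sum_{\theta\in\mathbb N^m}(-q)^{|\theta|}\mathcal U_{\mathbb L'_\theta(f)}$.
   Context: Setting: $\mathcal U=U_q(\mathfrak{sl}(\infty))$ over $\mathbb Q(q)$ with generators $E_a,F_a,K_{a,a+1}^{\pm1}$ ($a\in\mathbb Z$), comultiplication $\Delta(E_a)=1\otimes E_a+E_a\otimes K_{a,a+1}^{-1}$, $\Delta(F_a)=F_a\otimes1+K_{a,a+1}\otimes F_a$, bar map $\bar q=q^{-1}$ fixing $E_a,F_a$, inverting $K_{a,a+1}$. $\Lambda^k\mathbb V$ has basis $v_{a_1}\wedge\cdots\wedge v_{a_k}$ ($a_1>\cdots>a_k$), where for index set $S$: $F_a$ replaces $a$ by $a+1$ if $a\in S,a+1\notin S$ (else $0$), $E_a$ replaces $a+1$ by $a$ if $a+1\in S,a\notin S$ (else $0$), $K_{a,a+1}$ acts by $q^{[a\in S]-[a+1\in S]}$. $I(m|n)=\{-m,\dots,-1\}\cup\{1,\dots,n\}$; $\mathbb Z^{m+n}_+=\{f:I(m|n)\to\mathbb Z\mid f(-m)>\cdots>f(-1),\ f(1)>\cdots>f(n)\}$. $\mathcal E^{m+n}=\Lambda^m\mathbb V\otimes\Lambda^n\mathbb V$ with basis $\mathcal K_f=v_{f(-m)}\wedge\cdots\wedge v_{f(-1)}\otimes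 v_{f(1)}\wedge\cdots\wedge v_{f(n)}$. Bruhat ordering: transitive closure of $f<f\cdot\tau_{ij}$ for $i<j$ with $f(i)<f(j)$ ($(f\cdot\tau)(k)=f(\tau(k))$). Bar involution: the unique anti-linear involution on $\mathcal E^{m+n}$ fixing $\mathcal K_f$ for Bruhat-minimal $f\in\mathbb Z^{m+n}_+$, with $\overline{Xu}=\bar X\bar u$ and $\overline{\mathcal K_f}\in\mathcal K_f+\sum_{g<f}\mathbb Z[q,q^{-1}]\mathcal K_g$. $\mathcal U_f$ is the unique bar-invariant element of $\mathcal K_f+\sum_{g<f}q\mathbb Z[q]\mathcal K_g$. Pairs and operators: for $f\in\mathbb Z^{m+n}$ injective on negative and on positive indices, $(i|j)$ ($i<0<j$) is an atypical pair if $f(i)>f(j)$, $f(i)\notin\{f(k):k>0\}$, $f(j)\notin\{f(l):l<0\}$, with distance $f(i)-f(j)$; $\Sigma^k_f$ is the set of atypical pairs of distance $k$ sharing no entry with any pair in $\Sigma^1_f\cup\dots\cup\Sigma^{k-1}_f$; $\Sigma^+_f=\bigcup_k\Sigma^k_f$. For $-m\le i\le-1$, $\mathbb L_i(f)=f\cdot\tau_{ij}$ if $(i|j)\in\Sigma^+_f$ for some $j$, and $\mathbb L_i(f)=\emptyset$ otherwise; operators applied to $\emptyset$ give $\emptyset$. $f^+$ denotes the element of $\mathbb Z^{m+n}_+$ obtained by sorting values at negative positions decreasingly and at positive positions decreasingly, $\emptyset^+=\emptyset$, and $\mathcal K_\emptyset=\mathcal U_\emptyset=0$. For $\theta=(\theta_{-m},\dots,\theta_{-1})\in\mathbb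 N^m$, $|\theta|=\sum\theta_i$, $\mathbb L_\theta(f)=(\mathbb L_{-1}^{\theta_{-1}}\circ\mathbb L_{-2}^{\theta_{-2}}\circ\cdots\circ\mathbb L_{-m}^{\theta_{-m}}(f))^+$ and $\mathbb L'_\theta(f)=(\mathbb L_{-m}^{\theta_{-m}}\circ\cdots\circ\mathbb L_{-1}^{\theta_{-1}}(f))^+$. *)

(* Defs.v *)
From HB Require Import structures.
From mathcomp Require Import all_boot all_order all_algebra.
From mathcomp Require Import fraction.
From Stdlib Require Import Relations.
Set Implicit Arguments. Unset Strict Implicit. Unset Printing Implicit Defensive.
Import Order.TTheory GRing.Theory Num.Theory.
Local Open Scope ring_scope.

Notation Qq := {fraction {poly rat}}.
Definition qq : Qq := tofrac ('X : {poly rat}).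

Definition inLaurent (x : Qq) : Prop :=
  exists (p : {poly int}) (k : nat),
    x = (map_poly (fun z : int => z%:~R) p).[qq] / qq ^+ k.
Definition inqZq (x : Qq) : Prop :=
  exists p : {poly int}, x = qq * (map_poly (fun z : int => z%:~R) p).[qq].

Section E.
Variables m n : nat.

(* Index k : 'I_(m+n) encodes the position k-m (if k < m) in {-m,...,-1},
   and k-m+1 (if k >= m) in {1,...,n}; the order of 'I_(m+n) is the order
   of I(m|n). *)
Definition key := {ffun 'I_(m + n) -> int}.
Definition isneg (k : 'I_(m + n)) : bool := (k < m)%N.

Definition inZplus (f : key) : bool :=
  [forall i : 'I_(m + n), forall j : 'I_(m + n),
     ((i < j)%N && (isneg i == isneg j)) ==> (f j < f i)].

Definition swap (f : key) (i j : 'I_(m + n)) : key :=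
  [ffun k => if k == i then f j else if k == j then f i else f k].

Definition bruhat_step (f g : key) : Prop :=
  exists i j : 'I_(m + n), (i < j)%N /\ f i < f j /\ g = swap f i j.
Definition bruhat_lt : key -> key -> Prop := clos_trans key bruhat_step.
Definition bruhat_minimal (f : key) : Prop :=
  ~ exists g, inZplus g /\ bruhat_lt g f.

(* Elements of E^{m+n} are represented by their coefficient functions. *)
Definition vec := key -> Qq.
Definition isvec (v : vec) : Prop :=
  exists s : seq key, all inZplus s /\ forall g, g \notin s -> v g = 0.
Definition addv (u v : vec) : vec := fun g => u g + v g.
Definition scalev (c : Qq) (v : vec) : vec := fun g => c * v g.
Definition Kvec (f : key) : vec := fun g => (g == f)%:R.
Definition Kopt (o : option key) : vec :=
  match o with Some f => Kvec f | None => fun _ => 0 end.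

(* neg = true : first tensor factor (negative positions) *)
Definition inpart (neg : bool) (f : key) (a : int) : bool :=
  [exists k, (isneg k == neg) && (f k == a)].
Definition repl (neg : bool) (f : key) (a b : int) : key :=
  [ffun k => if (isneg k == neg) && (f k == a) then b else f k].
Definition cpart (neg : bool) (f : key) (a : int) : int :=
  (inpart neg f a : nat)%:Z - (inpart neg f (a + 1) : nat)%:Z.

(* Action of K_{a,a+1}^e (e = 1 or -1), acting by K (x) K. *)
Definition Kact (e : int) (a : int) (v : vec) : vec :=
  fun g => qq ^ (e * (cpart true g a + cpart false g a)) * v g.
(* Action of E_a via Delta(E_a) = 1 (x) E_a + E_a (x) K^{-1}. *)
Definition Eact (a : int) (v : vec) : vec := fun g =>
  (if inpart false g a && ~~ inpart false g (a + 1)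
   then v (repl false g a (a + 1)) else 0)
+ (if inpart true g a && ~~ inpart true g (a + 1)
   then qq ^ (- cpart false g a) * v (repl true g a (a + 1)) else 0).
(* Action of F_a via Delta(F_a) = F_a (x) 1 + K (x) F_a. *)
Definition Fact (a : int) (v : vec) : vec := fun g =>
  (if inpart true g (a + 1) && ~~ inpart true g a
   then v (repl true g (a + 1) a) else 0)
+ (if inpart false g (a + 1) && ~~ inpart false g a
   then qq ^ (cpart true g a) * v (repl false g (a + 1) a) else 0).

Record is_bar_involution (barF : Qq -> Qq) (psi : vec -> vec) : Prop := {
  bar_add : forall u v, isvec u -> isvec v -> psi (addv u v) = addv (psi u) (psi v);
  bar_scale : forall c u, isvec u -> psi (scalev c u) = scalev (barF c) (psi u);
  bar_invol : forall u, isvec u -> psi (psi u) = u;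
  bar_E : forall a u, isvec u -> psi (Eact a u) = Eact a (psi u);
  bar_F : forall a u, isvec u -> psi (Fact a u) = Fact a (psi u);
  bar_K : forall a u, isvec u -> psi (Kact 1 a u) = Kact (-1) a (psi u);
  bar_Kinv : forall a u, isvec u -> psi (Kact (-1) a u) = Kact 1 a (psi u);
  bar_min : forall f, inZplus f -> bruhat_minimal f -> psi (Kvec f) = Kvec f;
  bar_tri : forall f, inZplus f ->
    psi (Kvec f) f = 1 /\
    forall g, g != f -> inLaurent (psi (Kvec f) g) /\
      (psi (Kvec f) g != 0 -> inZplus g /\ bruhat_lt g f) }.

Definition is_canonical_basis (psi : vec -> vec) (U : key -> vec) : Prop :=
  forall f, inZplus f ->
    psi (U f) = U f /\ U f f = 1 /\
    forall g, g != f -> inqZq (U f g) /\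
      (U f g != 0 -> inZplus g /\ bruhat_lt g f).
Definition Uopt (U : key -> vec) (o : option key) : vec :=
  match o with Some f => U f | None => fun _ => 0 end.

Definition atyp (f : key) (i j : 'I_(m + n)) : bool :=
  [&& isneg i, ~~ isneg j, f j < f i,
      ~~ inpart false f (f i) & ~~ inpart true f (f j)].
Definition allpairs_idx : seq ('I_(m + n) * 'I_(m + n)) :=
  [seq (i, j) | i <- enum 'I_(m + n), j <- enum 'I_(m + n)].
Fixpoint sigma_upto (f : key) (K : nat) : seq ('I_(m + n) * 'I_(m + n)) :=
  match K with
  | 0 => [::]
  | K'.+1 =>
    let prev := sigma_upto f K' in
    prev ++ [seq p <- allpairs_idx |
              [&& atyp f p.1 p.2, f p.1 - f p.2 == (K'.+1 : nat)%:Z &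
                  all (fun p' => (p'.1 != p.1) && (p'.2 != p.2)) prev]]
  end.
(* (i|j) in Sigma^+_f  (a pair of distance d can only lie in Sigma^d_f) *)
Definition inSigmaPlus (f : key) (i j : 'I_(m + n)) : bool :=
  (i, j) \in sigma_upto f (absz (f i - f j)).

(* L_i for i the (i+1)-th negative position, i.e. position i - m. *)
Definition Lop (i : 'I_m) (f : key) : option key :=
  let i' := widen_ord (leq_addr n m) i in
  match [pick j | inSigmaPlus f i' j] with
  | Some j => Some (swap f i' j)
  | None => None
  end.

Definition sortplus (f : key) : key :=
  let negs := sort (fun x y : int => y <= x) [seq f k | k <- enum 'I_(m + n) & isneg k] in
  let poss := sort (fun x y : int => y <= x) [seq f k | k <- enum 'I_(m + n) & ~~ isneg k] in
  [ffun k => if isneg k then nth 0 negs k else nth 0 poss (k - m)%N].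

(* theta i is theta_{i-m}; L_theta applies L_{-m} first, L'_theta applies L_{-1} first. *)
Definition Ltheta (theta : 'I_m -> nat) (f : key) : option key :=
  omap sortplus (foldl (fun o i => iter (theta i) (obind (Lop i)) o) (Some f) (enum 'I_m)).
Definition Ltheta' (theta : 'I_m -> nat) (f : key) : option key :=
  omap sortplus (foldl (fun o i => iter (theta i) (obind (Lop i)) o) (Some f) (rev (enum 'I_m))).

End E.

(* Main.v *)
Require Import Defs.
From HB Require Import structures.
From mathcomp Require Import all_boot all_order all_algebra.
From mathcomp Require Import fraction zify perm.
From Stdlib Require Import FunctionalExtensionality.
Set Implicit Arguments. Unset Strict Implicit. Unset Printing Implicit Defensive.
Import Order.TTheory GRing.Theory Num.Theory.
Local Open Scope ring_scope.

(** In a weight diagram a vertex is a down arrow if it is an entry at negative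
    positions only, an up arrow if it is an entry at positive positions only,
    and a circle or a cross otherwise.  [inSigmaPlus] is the parenthesis
    matching of up arrows (opening) with down arrows (closing), and the matched
    pairs are drawn as cups.  Let [W f] be the sum of [q^|S| K_g] over the sets
    [S] of cups of [f], where [g] is [f] with the cups in [S] flipped.

    [W f] is bar invariant: an arrow slides past a circle or a cross under some
    [E_a] or [F_a], which shrinks an innermost cup until its ends are adjacent;
    then [W f = F_a (W f')], where [f'] has a cross and a circle in place of the
    cup.  Without cups [f] is Bruhat minimal.  By uniqueness [U_f = W f], even
    when the entries of [f] are not sorted.

    Flipping the cups one particle at a time, [W = (1 + q L_{-1}) ... (1 + q L_{-m})]
    provided that no particle lies inside the cup of (or, if that one is
    unmatched, to the left of) a particle that is flipped later.  Each
    [L'_theta] produces only configurations of this kind, so the second formula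
    follows by telescoping [(1 + q L_i) sum_k (-q L_i)^k = 1]. *)

Local Notation addv := Defs.addv.

(** * Keys and their sorted rearrangement *)

Section Keys.
Variables m n : nat.
Implicit Types (f g h : key m n) (i j k l : 'I_(m + n)) (b : bool) (a c x y : int).

(** Entries may repeat across the two signs, not within one. The operators produce such keys, in
    general unsorted. *)
Definition sinj f := forall k l, isneg k = isneg l -> f k = f l -> k = l.
(** For [sinj f]: the vertex [f k] carries an arrow rather than a cross. *)
Definition lone f k := [forall l, (f l == f k) ==> (l == k)].
Definition sameset f g := forall b a, inpart b f a = inpart b g a.
Definition vals b f := [seq f k | k <- enum 'I_(m + n) & isneg k == b].

Lemma inpartP b f a : reflect (exists2 k, isneg k = b & f k = a) (inpart b f a).
Proof.
apply: (iffP existsP) => [[k /andP[/eqP kb /eqP fk]]|[k kb fk]]; exists k => //.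
by rewrite kb fk !eqxx.
Qed.

Lemma loneP f k : reflect (forall l, f l = f k -> l = k) (lone f k).
Proof.
apply: (iffP forallP) => [H l e|H l]; last by apply/implyP => /eqP/H ->.
by have /implyP/(_ _)/eqP := H l; apply; rewrite e.
Qed.

Lemma inZplusP f :
  reflect (forall i j, (i < j)%N -> isneg i = isneg j -> f j < f i) (inZplus f).
Proof.
apply: (iffP forallP) => [H i j ij e|H i].
  by have /forallP/(_ j)/implyP := H i; apply; rewrite ij e eqxx.
by apply/forallP => j; apply/implyP => /andP[ij /eqP e]; exact: H.
Qed.

Lemma inZplus_sinj f : inZplus f -> sinj f.
Proof.
move=> /inZplusP H k l e ekl; apply: val_inj.
case: (ltngtP (val k) (val l)) => // kl; last by have := H _ _ kl (esym e); rewrite ekl ltxx.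
by have := H _ _ kl e; rewrite ekl ltxx.
Qed.

Lemma mem_vals b f a : (a \in vals b f) = inpart b f a.
Proof.
apply/mapP/inpartP => [[k]|[k kb fk]]; last by exists k => //; rewrite mem_filter mem_enum kb eqxx.
by rewrite mem_filter => /andP[/eqP kb _] ->; exists k.
Qed.

Lemma size_vals b f : size (vals b f) = if b then m else n.
Proof.
rewrite /vals size_map size_filter.
have -> : count (fun k : 'I_(m + n) => isneg k == b) (enum 'I_(m + n)) =
          count (fun p : nat => (p < m)%N == b) (map val (enum 'I_(m + n))) by rewrite count_map.
rewrite val_enum_ord iotaD count_cat /=.
have c1 : count (fun p : nat => (p < m)%N == b) (iota 0 m) = if b then m else 0.
  rewrite (@eq_in_count _ _ (fun=> b)); last first.
    by move=> k; rewrite mem_iota /= => ->; case: b.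
  by case: (b); rewrite ?count_predT ?count_pred0 ?size_iota.
have c2 : count (fun p : nat => (p < m)%N == b) (iota m n) = if b then 0 else n.
  rewrite (@eq_in_count _ _ (fun=> ~~ b)); last first.
    by move=> k; rewrite mem_iota => /andP[mk _]; rewrite ltnNge mk /=; case: (b).
  by case: (b); rewrite ?count_predT ?count_pred0 ?size_iota.
by rewrite c1 c2; case: (b); rewrite ?addn0.
Qed.

Lemma uniq_vals b f : sinj f -> uniq (vals b f).
Proof.
move=> fi; rewrite map_inj_in_uniq ?(filter_uniq _ (enum_uniq _)) // => k l.
by rewrite !mem_filter => /andP[/eqP kb _] /andP[/eqP lb _] e; apply: fi => //; rewrite kb lb.
Qed.

Lemma sorted_vals b f : inZplus f -> sorted >%R (vals b f).
Proof.
move=> /inZplusP H; rewrite sorted_map.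
have s0 : sorted (fun k l : 'I_(m + n) => k < l)%N (enum 'I_(m + n)).
  have := iota_ltn_sorted 0 (m + n); rewrite -val_enum_ord sorted_map.
  exact: sub_sorted.
have s1 : sorted (fun k l : 'I_(m + n) => k < l)%N
    [seq k <- enum 'I_(m + n) | isneg k == b].
  by apply: sorted_filter s0 => y x z; apply: ltn_trans.
have al : all [pred k | isneg k == b] [seq k <- enum 'I_(m + n) | isneg k == b].
  exact: filter_all.
move: s1; apply: (sub_in_sorted (P := fun k => isneg k == b)) => // k l.
by move=> /eqP kb /eqP lb kl; apply: H => //; rewrite kb lb.
Qed.

(** A strictly decreasing list is determined by the set of its members. *)
Lemma inZplus_ext f g : inZplus f -> inZplus g -> sameset f g -> f = g.
Proof.
move=> fd gd e; apply/ffunP => k.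
have : vals (isneg k) f = vals (isneg k) g.
  apply: (@irr_sorted_eq _ >%R); rewrite ?sorted_vals //.
  - by move=> y x z /= xy yz; apply: lt_trans yz xy.
  - by move=> x /=; rewrite ltxx.
  - by move=> x; rewrite !mem_vals e.
by move/eq_in_map/(_ k); apply; rewrite mem_filter mem_enum eqxx.
Qed.

Lemma sortplusE f k : sortplus f k =
  nth 0 (sort (fun x y : int => y <= x) (vals (isneg k) f)) (if isneg k then k : nat else (k - m)%N).
Proof.
rewrite ffunE /vals; case: (isneg k).
  by congr (nth _ (sort _ (map _ _)) _); apply: eq_filter => l; case: (isneg l).
by congr (nth _ (sort _ (map _ _)) _); apply: eq_filter => l; case: (isneg l).
Qed.

Let ix k := (if isneg k then k : nat else (k - m)%N).

Lemma ix_lt f k : (ix k < size (vals (isneg k) f))%N.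
Proof.
rewrite size_vals /ix /isneg; have := ltn_ord k.
by case: (ltnP k m) => /= mk kl; lia.
Qed.

Lemma sortplus_inZplus f : sinj f -> inZplus (sortplus f).
Proof.
move=> fi; apply/inZplusP => i j ij e; rewrite !sortplusE -/(ix i) -/(ix j).
rewrite -e; set s := sort _ _.
have ss : sorted >%R s.
  have -> : sorted >%R s = sorted (fun x y : int => y < x) s by [].
  have := @sort_le_sorted _ int (vals (isneg i) f).
  have : uniq s by rewrite sort_uniq uniq_vals.
  have : sorted (fun x y : int => y <= x) s.
    by apply: sort_sorted => x y; exact: le_total.
  elim: s => //= x [|y s] IH //= /andP[yx p] /andP[xn u] H.
  rewrite lt_neqAle yx andbT; apply/andP; split.
    by apply: contra xn => /eqP ->; rewrite inE eqxx.
  by apply: IH.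
have szs : size s = size (vals (isneg i) f) by rewrite size_sort.
apply: (sorted_ltn_nth (leT := fun x y : int => y < x) _ 0 ss) => //.
- by move=> y x z /= xy yz; apply: lt_trans yz xy.
- by rewrite inE szs ix_lt.
- by rewrite inE szs e ix_lt.
rewrite /ix -e; move: e; rewrite /isneg; case: ltnP => // mi /esym.
move/negbT; rewrite -leqNgt => mj; lia.
Qed.

Lemma sortplus_sameset f : sameset (sortplus f) f.
Proof.
move=> b a; rewrite -(mem_vals _ f) -(mem_sort (fun x y : int => y <= x)).
apply/inpartP/(nthP 0) => [[k kb]|].
  rewrite sortplusE -/(ix k) kb => <-; exists (ix k) => //.
  by rewrite size_sort -kb ix_lt.
rewrite size_sort => -[p]; rewrite size_vals => pl <-.
have kl : ((if b then p else m + p) < m + n)%N by case: b pl => pl; lia.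
have nb : isneg (Ordinal kl) = b by rewrite /isneg /=; case: b pl kl => pl kl; lia.
exists (Ordinal kl) => //; rewrite sortplusE nb.
by rewrite /=; congr (nth _ _ _); clear; case: b => //=; rewrite addKn.
Qed.

Lemma eq_sortplus f h : sinj f -> (h = sortplus f) <-> (inZplus h /\ sameset h f).
Proof.
move=> fi; split=> [->|[hd hs]].
  by split; [exact: sortplus_inZplus | exact: sortplus_sameset].
apply: inZplus_ext => //; first exact: sortplus_inZplus.
by move=> b a; rewrite hs sortplus_sameset.
Qed.

Lemma sortplus_id f : inZplus f -> sortplus f = f.
Proof.
move=> fd; symmetry; apply/eq_sortplus; first exact: inZplus_sinj.
by split.
Qed.

Lemma sortplus_ext f g : sinj f -> sinj g -> sameset f g -> sortplus f = sortplus g.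
Proof.
move=> fi gi e; apply/(eq_sortplus _ gi); split; first exact: sortplus_inZplus.
by move=> b a; rewrite sortplus_sameset e.
Qed.

Lemma swapE f i j k : swap f i j k = f (tperm i j k).
Proof. by rewrite ffunE permE /=; case: eqVneq => // ki; case: eqVneq. Qed.

Lemma swap_id f i j k : k != i -> k != j -> swap f i j k = f k.
Proof. by move=> ki kj; rewrite swapE tpermD 1?eq_sym. Qed.

Lemma swapL f i j : swap f i j i = f j. Proof. by rewrite swapE tpermL. Qed.
Lemma swapR f i j : swap f i j j = f i. Proof. by rewrite swapE tpermR. Qed.

Lemma lone_swap f i j k : lone (swap f i j) k = lone f (tperm i j k).
Proof.
apply/loneP/loneP => H l.
  have := H (tperm i j l); rewrite !swapE tpermK => H' /H' <-.
  by rewrite tpermK.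
by rewrite !swapE => /H /perm_inj.
Qed.

(** A lone entry occurs nowhere else, so exchanging two of them creates no repetition, even across
    the signs. *)
Lemma sinj_swap f i j : sinj f -> lone f i -> lone f j -> sinj (swap f i j).
Proof.
move=> fi /loneP li /loneP lj k l e; rewrite !swapE => H.
case: (eqVneq (tperm i j k) i) => [ki|ki].
  by apply: (@perm_inj _ (tperm i j)); rewrite ki in H *; rewrite (li _ (esym H)).
case: (eqVneq (tperm i j k) j) => [kj|kj].
  by apply: (@perm_inj _ (tperm i j)); rewrite kj in H *; rewrite (lj _ (esym H)).
case: (eqVneq (tperm i j l) i) => [il|il].
  by apply: (@perm_inj _ (tperm i j)); rewrite il in H *; rewrite (li _ H).
case: (eqVneq (tperm i j l) j) => [jl|jl].
  by apply: (@perm_inj _ (tperm i j)); rewrite jl in H *; rewrite (lj _ H).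
have ft p : tperm i j p != i -> tperm i j p != j -> tperm i j p = p.
  by case: tpermP => // [_ _|_]; rewrite eqxx.
by apply: fi => //; rewrite -(ft k) // H ft.
Qed.

Lemma swapC f i j i' j' : i != i' -> i != j' -> j != i' -> j != j' ->
  swap (swap f i j) i' j' = swap (swap f i' j') i j.
Proof.
move=> n1 n2 n3 n4; apply/ffunP => k; rewrite !swapE.
case: (tpermP i' j' k) => [->|->|/eqP k1 /eqP k2]; rewrite ?(tpermD n1 n3) ?(tpermD n2 n4).
- by rewrite tpermL // tpermD.
- by rewrite tpermR // tpermD.
case: (tpermP i j k) => [_|_|_ _]; rewrite tpermD // eq_sym //.
Qed.

End Keys.

(** * Cups *)

Section Cups.
Variables m n : nat.
Implicit Types (f g h : key m n) (i j k l : 'I_(m + n)) (b : bool) (a c x y : int).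
Implicit Types (p q : 'I_(m + n) * 'I_(m + n)).

Lemma lone_inpart f k : sinj f -> lone f k = ~~ inpart (~~ isneg k) f (f k).
Proof.
move=> fi; apply/loneP/idP => [H|H l e].
  by apply/negP => /inpartP[l lb /H lk]; move: lb; rewrite lk; case: (isneg k).
case: (boolP (isneg l == isneg k)) => [/eqP lk|lk]; first exact: fi.
by case/negP: H; apply/inpartP; exists l => //; case: (isneg l) lk; case: (isneg k).
Qed.

Lemma atypE f i j : sinj f ->
  atyp f i j = [&& isneg i, ~~ isneg j, f j < f i, lone f i & lone f j].
Proof.
move=> fi; rewrite /atyp !lone_inpart //.
by case: (isneg i) => //=; case: (isneg j).
Qed.

Lemma mem_allpairs_idx p : p \in allpairs_idx m n.
Proof. by apply/allpairsP; exists p; rewrite !mem_enum; case: p. Qed.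

Lemma sigma_atyp f K p : p \in sigma_upto f K ->
  atyp f p.1 p.2 && (f p.1 - f p.2 <= K%:Z).
Proof.
elim: K => //= K IH; rewrite mem_cat => /orP[/IH /andP[-> H]|].
  by apply: le_trans H _; lia.
by rewrite mem_filter => /andP[/and3P[-> /eqP -> _] _] /=.
Qed.

Lemma sigma_step f K p : f p.1 - f p.2 <= K%:Z ->
  (p \in sigma_upto f K.+1) = (p \in sigma_upto f K).
Proof.
move=> H /=; rewrite mem_cat; case: (p \in _) => //=.
by apply/negbTE; rewrite mem_filter; apply/negP => /andP[/and3P[_ /eqP e _] _]; lia.
Qed.

(** A pair is added at the stage equal to its distance or never, so all later stages agree on it. *)
Lemma mem_sigma f K p : f p.1 - f p.2 <= K%:Z ->
  (p \in sigma_upto f K) = inSigmaPlus f p.1 p.2.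
Proof.
case: p => i j /= H; rewrite /inSigmaPlus; set d := absz _.
case: (ltP (f j) (f i)) => [ij|ij]; last first.
  by apply/idP/idP => /sigma_atyp /andP[/and5P[_ _]]; rewrite ltNge ij.
have dK : (d <= K)%N by rewrite /d; lia.
have hd : f i - f j <= d%:Z by rewrite /d; lia.
rewrite -(subnK dK); elim: (K - d)%N => [//|r IH].
rewrite addSn sigma_step //=.
by apply: le_trans hd _; lia.
Qed.

(** Pairs added at different stages are disjoint by the filter. Pairs of one stage have equal
    distance, so a common end forces the other entry, and [sinj] its position. *)
Lemma sigma_disj f K p q : sinj f -> p \in sigma_upto f K -> q \in sigma_upto f K ->
  p.1 = q.1 \/ p.2 = q.2 -> p = q.
Proof.
move=> fi; elim: K p q => // K IH p q /=; rewrite !mem_cat => /orP[hp|hp] /orP[hq|hq] e.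
- exact: IH.
- move: hq; rewrite mem_filter => /andP[/and3P[_ _ /allP/(_ _ hp) /andP[/eqP n1 /eqP n2]] _].
  by case: e.
- move: hp; rewrite mem_filter => /andP[/and3P[_ _ /allP/(_ _ hq) /andP[/eqP n1 /eqP n2]] _].
  by case: e => /esym.
move: hp hq; rewrite !mem_filter => /andP[/and3P[pa /eqP pd _] _] /andP[/and3P[qa /eqP qd _] _].
case: p q pa pd qa qd e => i j [i' j'] /= /and5P[ni nj _ _ _] pd /and5P[ni' nj' _ _ _] qd [e|e].
  rewrite e; congr pair; apply: fi; first by rewrite (negbTE nj) (negbTE nj').
  by subst; lia.
rewrite e; congr pair; apply: fi; first by rewrite ni ni'.
by subst; lia.
Qed.

Lemma sigma_uniq f K : uniq (sigma_upto f K).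
Proof.
elim: K => //= K IH; rewrite cat_uniq IH /= filter_uniq ?andbT.
  apply/hasPn => p; rewrite mem_filter => /andP[/and3P[_ _ /allP H] _].
  by apply/negP => /H; rewrite eqxx.
apply: allpairs_uniq; rewrite ?enum_uniq //.
by move=> [? ?] [? ?] _ _ [-> ->].
Qed.

Lemma inSigma_atyp f i j : inSigmaPlus f i j -> atyp f i j.
Proof. by move/sigma_atyp => /andP[]. Qed.

Lemma inSigma_uniq f p q : sinj f -> inSigmaPlus f p.1 p.2 -> inSigmaPlus f q.1 q.2 ->
  p.1 = q.1 \/ p.2 = q.2 -> p = q.
Proof.
move=> fi hp hq; pose K := maxn (absz (f p.1 - f p.2)) (absz (f q.1 - f q.2)).
by apply: (@sigma_disj f K) => //; rewrite mem_sigma // /K; lia.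
Qed.

(** The construction is greedy: an atypical pair that is left out was blocked by a shorter chosen
    pair sharing an end with it. *)
Lemma inSigma_max f i j : atyp f i j -> exists p,
  [/\ inSigmaPlus f p.1 p.2, p.1 = i \/ p.2 = j & f p.1 - f p.2 <= f i - f j].
Proof.
move=> a; have lt : f j < f i by case/and5P: a.
case H: (inSigmaPlus f i j); first by exists (i, j); split => //; left.
move: H; rewrite {1}/inSigmaPlus; case E: (absz (f i - f j)) => [|d]; first by lia.
rewrite /= mem_cat => /norP[_]; rewrite mem_filter mem_allpairs_idx andbT /= a /=.
have -> : f i - f j == d.+1%:Z by lia.
case/allPn => p hp; rewrite negb_and !negbK => e; exists p.
have /andP[_ dp] := sigma_atyp hp; split.
- by rewrite -(@mem_sigma f d).
- by case/orP: e => /eqP; auto.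
by lia.
Qed.

(** Every arrow under a cup is matched under the same cup. Pair [k] with the opposite end of the
    cup; the pair given by [inSigma_max] is too short to be the cup itself, so it contains [k], and
    its length confines the other end. *)
Lemma inSigma_inner f i j k : sinj f -> inSigmaPlus f i j -> lone f k ->
  f j < f k -> f k < f i ->
  exists p, [/\ inSigmaPlus f p.1 p.2, k = (if isneg k then p.1 else p.2),
                f j < f p.2, f p.1 < f i & f p.2 < f p.1].
Proof.
move=> fi M lk jk ki; have a := inSigma_atyp M.
move: (a); rewrite atypE // => /and5P[ni nj ij li lj].
case nk: (isneg k).
  have ak : atyp f k j by rewrite atypE // nk nj jk lk lj.
  have [p [Mp e dp]] := inSigma_max ak; have /and5P[_ _ pp _ _] := inSigma_atyp Mp.
  have n2 : p.2 <> j.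
    by move=> e2; have := inSigma_uniq fi Mp (q := (i, j)) M (or_intror e2) => e3; move: dp; rewrite e3 /= => dp; clear -jk ki dp; lia.
  case: e => // e; exists p; split=> //; rewrite -?e //; last by rewrite e.
  rewrite e in dp; have : f p.2 <> f j; last by lia.
  by move=> e4; apply: n2; move/loneP: lj; apply.
have ak : atyp f i k by rewrite atypE // nk ni ki lk li.
have [p [Mp e dp]] := inSigma_max ak; have /and5P[_ _ pp _ _] := inSigma_atyp Mp.
have n1 : p.1 <> i.
  by move=> e2; have := inSigma_uniq fi Mp (q := (i, j)) M (or_introl e2) => e3; move: dp; rewrite e3 /= => dp; clear -jk ki dp; lia.
case: e => // e; exists p; split=> //; rewrite -?e //; first by rewrite e.
rewrite e in dp; have : f p.1 <> f i; last by lia.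
by move=> e4; apply: n1; move/loneP: li; apply.
Qed.

(** * Locality of the matching *)

Definition convex (r : int -> bool) := forall x y z, r x -> r z -> x <= y -> y <= z -> r y.
Definition agree (r : int -> bool) f f' := forall k, r (f k) || r (f' k) -> f k = f' k.

Lemma agree_sym r f f' : agree r f f' -> agree r f' f.
Proof. by move=> H k; rewrite orbC => /H. Qed.

Lemma agree_inpart r f f' b a : agree r f f' -> r a -> inpart b f a -> inpart b f' a.
Proof.
move=> H ra /inpartP[k kb e]; apply/inpartP; exists k => //.
by rewrite -H // e ra.
Qed.

(** Whether a pair is chosen depends only on the diagram between its ends. The two keys alternate in
    the induction, so both are generalized. *)
Lemma sigma_local r f f' K p : convex r -> agree r f f' ->
  r (f p.1) -> r (f p.2) -> p \in sigma_upto f K -> p \in sigma_upto f' K.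
Proof.
move=> cv; elim: K f f' p => // K IH f f' p ag r1 r2 /=; rewrite !mem_cat.
case/orP=> [/IH -> //|]; rewrite !mem_filter => /andP[/and3P[ap dp /allP np] _].
have e1 : f p.1 = f' p.1 by rewrite ag // r1.
have e2 : f p.2 = f' p.2 by rewrite ag // r2.
apply/orP; right; rewrite mem_allpairs_idx andbT; apply/and3P; split.
- move: ap; rewrite /atyp -e1 -e2 => /and5P[-> -> -> n1 n2] /=; apply/andP; split.
    by apply: contra n1; apply: (agree_inpart (agree_sym ag)).
  by apply: contra n2; apply: (agree_inpart (agree_sym ag)).
- by rewrite -e1 -e2.
(* A pair [q] blocking [p] in [f'] shares an end with it and is shorter, so its other end lies
   between the ends of [p]. Hence [q] is in the range of [r] and blocks [p] in [f] as well. *)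
apply/allP => q hq; apply/negPn/negP => sh.
have /andP[/and5P[_ _ lq _ _] dq] := sigma_atyp hq.
suff /andP[s1 s2] : r (f' q.1) && r (f' q.2).
  have := np q (IH f' f q (agree_sym ag) s1 s2 hq).
  by rewrite negb_and !negbK in sh; case/orP: sh => /eqP ->; rewrite ?eqxx ?andbF.
move/eqP: dp => dp; rewrite e1 e2 in dp r1 r2.
rewrite negb_and !negbK in sh; case/orP: sh => /eqP e; rewrite -e in dp r1 r2; rewrite ?r1 ?r2 /= ?andbT.
  by apply: (cv _ _ _ r2 r1); lia.
by apply: (cv _ _ _ r2 r1); lia.
Qed.

Lemma inSigma_local r f f' i j : convex r -> agree r f f' ->
  r (f i) -> r (f j) -> inSigmaPlus f i j -> inSigmaPlus f' i j.
Proof.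
move=> cv ag ri rj; have ei := ag i; have ej := ag j; rewrite ri in ei; rewrite rj in ej.
rewrite /inSigmaPlus -(ei isT) -(ej isT).
exact: (@sigma_local r f f' _ (i, j)).
Qed.

Definition partner f i := [pick j | inSigmaPlus f i j].

Lemma partner_some f i j : sinj f -> (partner f i == Some j) = inSigmaPlus f i j.
Proof.
move=> fi; rewrite /partner; case: pickP => [j' M|->] //.
apply/eqP/idP => [[<-]//|M'].
by have := inSigma_uniq fi (p := (i, j')) (q := (i, j)) M M' (or_introl erefl) => -[->].
Qed.

Lemma partnerP f i : sinj f -> {j | inSigmaPlus f i j & partner f i = Some j} +
   {partner f i = None /\ forall j, ~~ inSigmaPlus f i j}.
Proof.
move=> fi; rewrite /partner; case: pickP => [j M|H]; first by left; exists j.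
by right; split=> // j; rewrite H.
Qed.

(* The interval spanned by the cup of [l], a half-line if [l] is an unmatched
   arrow, and a point if [l] belongs to a cross. *)
Definition shadow f l x := (x <= f l) &&
  (if partner f l is Some j then f j <= x else (~~ lone f l ==> (x == f l))).

(** Locality applied to the shadow, which is convex. The shadow of an unmatched arrow is a whole
    half-line, so a partner in [f'] would already be one in [f]. *)
Lemma shadow_local f f' l : sinj f -> sinj f' -> isneg l ->
  agree (shadow f l) f f' -> partner f' l = partner f l /\ shadow f' l =1 shadow f l.
Proof.
move=> fi fi' nl ag.
have cv : convex (shadow f l).
  rewrite /shadow => x y z /andP[h1 h2] /andP[h3 h4] h5 h6.
  apply/andP; split; first by lia.
  case: (partner f l) h2 h4 => [j|]; first by lia.
  by case: (~~ _) => //=; lia.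
have sl : shadow f l (f l).
  rewrite /shadow lexx /=; case: (partnerP l fi) => [[j M ->]|[-> _]]; last by rewrite eqxx implybT.
  by have /and5P[_ _ /ltW] := inSigma_atyp M.
have el : f l = f' l by rewrite ag // sl.
have ll : lone f' l = lone f l.
  rewrite !lone_inpart // -el; congr (~~ _).
  by apply/idP/idP; [apply: (agree_inpart (agree_sym ag)) | apply: (agree_inpart ag)].
suff pe : partner f' l = partner f l.
  split=> // x; rewrite /shadow pe ll -el; case: (partnerP l fi) => [[j M pj]|[-> _]] //.
  rewrite pj -ag // /shadow pj lexx /=.
  by have /and5P[_ _ /ltW -> ] := inSigma_atyp M.
case: (partnerP l fi) => [[j M pj]|[pn Mn]].
  rewrite pj; apply/eqP; rewrite partner_some //.
  apply: (inSigma_local cv ag sl _ M).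
  by rewrite /shadow pj lexx andbT; have /and5P[_ _ /ltW] := inSigma_atyp M.
rewrite pn; case: (partnerP l fi') => [[j M' _]|[-> //]].
have a' := inSigma_atyp M'; move: (a'); rewrite atypE // ll => /and5P[_ _ lt lo _].
case/negP: (Mn j); apply: (inSigma_local cv (agree_sym ag) _ _ M'); first by rewrite -el.
by rewrite /shadow pn lo /= andbT el ltW.
Qed.

Lemma swap_agree r f i j : ~~ r (f i) -> ~~ r (f j) -> agree r f (swap f i j).
Proof.
move=> /negbTE ri /negbTE rj k; rewrite swapE.
by case: tpermP => [->|->|//]; rewrite ?ri ?rj.
Qed.

(* Cups do not cross, so a cup whose right end avoids the shadow of [l] is
   disjoint from it. *)
Lemma flip_shadow f i j l : sinj f -> inSigmaPlus f i j -> isneg l -> l != i ->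
  ~~ shadow f l (f i) ->
  [/\ ~~ shadow f l (f j), partner (swap f i j) l = partner f l
    & shadow (swap f i j) l =1 shadow f l].
Proof.
move=> fi M nl li sh; have a := inSigma_atyp M.
move: (a); rewrite atypE // => /and5P[ni nj ij lo lj].
suff sj : ~~ shadow f l (f j).
  have [] := @shadow_local f (swap f i j) l fi _ nl (swap_agree sh sj) => //.
  exact: sinj_swap.
have jl : f j <> f l by move=> e; have := (loneP _ _ lj) l (esym e) => e'; rewrite e' (negbTE nj) in nl.
have il : f i <> f l by move=> e; have := (loneP _ _ lo) l (esym e) => e'; rewrite e' eqxx in li.
move: sh; rewrite /shadow; case: (partnerP l fi) => [[j' M' ->]|[pn Mn]].
  move: (inSigma_atyp M'); rewrite atypE // => /and5P[_ nj' lj' lol loj'].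
  rewrite negb_and -!ltNge => sh; apply/negP => /andP[h1 h2].
  have jj' : f j' <> f j.
    move=> e; have e' := (loneP _ _ lj) j' e; rewrite e' in M'.
    have := inSigma_uniq fi (p := (i, j)) (q := (l, j)) M M' (or_intror erefl).
    by case=> /esym/eqP; rewrite (negbTE li).
  have Lj : f j' < f j by rewrite lt_neqAle h2 andbT; apply/eqP.
  have Lj' : f j < f l by rewrite lt_neqAle h1 andbT; apply/eqP.
  (* If [j] were strictly under the cup of [l], so would be its partner [i], contrary to the
     hypothesis on [f i]. *)
  have [p [Mp e l1 l2 l3]] := inSigma_inner (k := j) fi M' lj Lj Lj'.
  rewrite (negbTE nj) in e.
  have := inSigma_uniq fi (q := (i, j)) Mp M (or_intror (esym e)) => ep.
  move: l2; rewrite ep /= => l2; case/orP: sh => [/lt_trans/(_ l2)|/lt_trans/(_ Lj)/lt_trans/(_ ij)].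
    by rewrite ltxx.
  by rewrite ltxx.
rewrite pn; case lol: (lone f l) => /=; rewrite ?andbT.
  move=> sh; apply/negP => h1.
  have Lj : f j < f l by rewrite lt_neqAle h1 andbT; apply/eqP.
  have Li : f l < f i by rewrite ltNge.
  (* An arrow strictly under the cup of [i] and [j] is matched, but [l] is not. *)
  have [p [Mp e l1 l2 l3]] := inSigma_inner (k := l) fi M lol Lj Li.
  by rewrite nl in e; rewrite e in Mn; have := Mn p.2; rewrite Mp.
by move=> _; apply/negP => /andP[_ /eqP].
Qed.

End Cups.

(** * Action of the generators *)

Section Act.
Variables m n : nat.
Implicit Types (f g h : key m n) (i j k l : 'I_(m + n)) (b : bool) (a c x y : int).
Implicit Types (p q : 'I_(m + n) * 'I_(m + n)) (u v : vec m n).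

Lemma inpart_repl b f x y b' z : x != y -> inpart b f x -> ~~ inpart b f y ->
  inpart b' (repl b f x y) z =
  if b' == b then (if z == y then true else if z == x then false else inpart b f z)
  else inpart b' f z.
Proof.
move=> xy hx hy; case: (eqVneq b' b) => [->|bb].
  case: (eqVneq z y) => [->|zy].
    by case/inpartP: hx => k kb <-; apply/inpartP; exists k; rewrite // ffunE kb !eqxx.
  case: (eqVneq z x) => [->|zx].
    apply/negbTE/negP => /inpartP[k kb]; rewrite ffunE kb eqxx /=.
    by case: (eqVneq (f k) x) => [_ e|/eqP]; [rewrite e eqxx in xy|].
  apply/inpartP/inpartP => -[k kb]; rewrite ?ffunE ?kb ?eqxx /=.
    by case: (eqVneq (f k) x) => [_ e|_ e]; [rewrite e eqxx in zy|exists k].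
  by move=> e; exists k; rewrite // ffunE e (negbTE zx) andbF.
apply/inpartP/inpartP => -[k kb]; rewrite ?ffunE ?kb ?(negbTE bb) /= => e; exists k => //.
by rewrite ffunE kb (negbTE bb).
Qed.

Lemma repl_repl b f x y : ~~ inpart b f y -> repl b (repl b f x y) y x = f.
Proof.
move=> hy; apply/ffunP => k; rewrite !ffunE; case: (eqVneq (isneg k) b) => //= kb.
case: (eqVneq (f k) x) => [->|fx]; first by rewrite eqxx.
by case: eqVneq => // fy; case/inpartP: hy; exists k.
Qed.

Lemma sinj_repl b f x y : sinj f -> ~~ inpart b f y -> sinj (repl b f x y).
Proof.
move=> fi hy k l e; rewrite !ffunE e; case: (eqVneq (isneg l) b) => /= lb; last exact: fi.
case: (eqVneq (f k) x) => kx; case: (eqVneq (f l) x) => lx.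
- by move=> _; apply: fi => //; rewrite kx lx.
- by move=> yl; case/inpartP: hy; exists l.
- by move=> yl; case/inpartP: hy; exists k; rewrite ?e.
exact: fi.
Qed.

(** No integer lies strictly between neighbours, so a move by one onto a free vertex overtakes no
    entry. *)
Lemma inZplus_repl b f x y : x = y + 1 \/ y = x + 1 -> ~~ inpart b f y ->
  inZplus f -> inZplus (repl b f x y).
Proof.
move=> xy hy /inZplusP H; apply/inZplusP => i j ij e; have := H _ _ ij e; rewrite !ffunE e.
case: (eqVneq (isneg j) b) => //= jb lt.
have ny k : isneg k = b -> f k <> y by move=> kb ky; case/inpartP: hy; exists k.
have := ny j jb; have := ny i (etrans e jb).
by case: (eqVneq (f i) x) => ix; case: (eqVneq (f j) x) => jx; lia.
Qed.

(** The action is defined by pulling the argument [g] back along a move. This turns it into pushing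
    [f] forward, which gives the action on basis vectors. *)
Lemma act_term b f g x y : x = y + 1 \/ y = x + 1 -> sinj f ->
  (inpart b g y && ~~ inpart b g x) && (repl b g y x == sortplus f) =
  (inpart b f x && ~~ inpart b f y) && (g == sortplus (repl b f x y)).
Proof.
move=> xy fi; have nxy : x != y by apply/eqP; lia.
have nyx : y != x by rewrite eq_sym.
apply/idP/idP => /andP[/andP[h1 h2] /eqP e].
  have [d s] : inZplus (repl b g y x) /\ sameset (repl b g y x) f by apply/eq_sortplus.
  have hx : inpart b f x by rewrite -s inpart_repl // !eqxx.
  have hy : ~~ inpart b f y by rewrite -s inpart_repl // !eqxx (negbTE nyx).
  rewrite hx hy; apply/eqP/eq_sortplus; first exact: sinj_repl.
  have ge : repl b (repl b g y x) x y = g by apply: repl_repl.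
  split; first by rewrite -ge; apply: inZplus_repl; rewrite ?s.
  by move=> b' z; rewrite -ge; rewrite !(@inpart_repl b _ x y) ?s //; case: ifP => // /eqP ->.
have si : sinj (repl b f x y) by exact: sinj_repl.
have [d s] : inZplus g /\ sameset g (repl b f x y) by apply/eq_sortplus.
have hx : inpart b g y by rewrite s inpart_repl // !eqxx.
have hy : ~~ inpart b g x by rewrite s inpart_repl // !eqxx (negbTE nxy).
rewrite hx hy; apply/eqP/eq_sortplus => //; split.
  by apply: inZplus_repl => //; case: xy; auto.
have fe : repl b (repl b f x y) y x = f by apply: repl_repl.
by move=> b' z; rewrite -fe !(@inpart_repl b _ y x) -?s //; rewrite s.
Qed.

Definition zerov : vec m n := fun _ => 0.
Definition guard b v : vec m n := if b then v else zerov.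

Lemma scale_nat (t : bool) (x : Qq) : (if t then x else 0) = t%:R * x.
Proof. by case: t; rewrite ?mul1r ?mul0r. Qed.

Lemma Fact_K f a : sinj f -> Fact a (Kvec (sortplus f)) =
  addv (guard (inpart true f a && ~~ inpart true f (a + 1))
          (Kvec (sortplus (repl true f a (a + 1)))))
       (guard (inpart false f a && ~~ inpart false f (a + 1))
          (scalev (qq ^ cpart true f a) (Kvec (sortplus (repl false f a (a + 1)))))).
Proof.
move=> fi; apply: functional_extensionality => g; rewrite /Fact /addv /Kvec.
have gE t v : guard t v g = t%:R * v g by case: t; rewrite ?mul1r ?mul0r.
have an : a != a + 1 by apply/eqP; lia.
have aa : a = a + 1 + 1 \/ a + 1 = a + 1 by right.
rewrite !gE !scale_nat; congr (_ + _).
  by rewrite -!natrM !mulnb act_term.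
rewrite /scalev; set A := inpart false g _ && _; set B := inpart false f _ && _.
have := act_term false g aa fi; rewrite -/A -/B => e.
rewrite mulrCA [RHS]mulrCA -!natrM !mulnb e.
case: (boolP B) => //= hB; rewrite ?mulr0 //.
case: eqVneq => ge; rewrite ?mulr0 //; congr (qq ^ _ * _).
have /andP[h1 h2] := hB.
(* The move takes place in the other tensor factor, so the exponent is the same at [g] and at
   [f]. *)
by rewrite ge /cpart !sortplus_sameset !inpart_repl.
Qed.

Lemma Eact_K f a : sinj f -> Eact a (Kvec (sortplus f)) =
  addv (guard (inpart false f (a + 1) && ~~ inpart false f a)
          (Kvec (sortplus (repl false f (a + 1) a))))
       (guard (inpart true f (a + 1) && ~~ inpart true f a)
          (scalev (qq ^ (- cpart false f a)) (Kvec (sortplus (repl true f (a + 1) a))))).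
Proof.
move=> fi; apply: functional_extensionality => g; rewrite /Eact /addv /Kvec.
have gE t v : guard t v g = t%:R * v g by case: t; rewrite ?mul1r ?mul0r.
have an : a + 1 != a by apply/eqP; lia.
have aa : a + 1 = a + 1 \/ a = a + 1 + 1 by left.
rewrite !gE !scale_nat; congr (_ + _).
  by rewrite -!natrM !mulnb act_term.
rewrite /scalev; set A := inpart true g _ && _; set B := inpart true f _ && _.
have := act_term true g aa fi; rewrite -/A -/B => e.
rewrite mulrCA [RHS]mulrCA -!natrM !mulnb e.
case: (boolP B) => //= hB; rewrite ?mulr0 //.
case: eqVneq => ge; rewrite ?mulr0 //; congr (qq ^ (- _) * _).
have /andP[h1 h2] := hB.
by rewrite ge /cpart !sortplus_sameset !inpart_repl.
Qed.

Lemma Fact_add a u v : Fact a (addv u v) = addv (Fact a u) (Fact a v).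
Proof.
apply: functional_extensionality => g; rewrite /Fact /addv !scale_nat !mulrDr.
by rewrite addrACA.
Qed.
Lemma Eact_add a u v : Eact a (addv u v) = addv (Eact a u) (Eact a v).
Proof.
apply: functional_extensionality => g; rewrite /Eact /addv !scale_nat !mulrDr.
by rewrite addrACA.
Qed.
Lemma Fact_scale a (t : Qq) v : Fact a (scalev t v) = scalev t (Fact a v).
Proof.
apply: functional_extensionality => g; rewrite /Fact /scalev mulrDr.
by congr (_ + _); case: ifP => _; rewrite ?mulr0 //; apply: mulrCA.
Qed.
Lemma Eact_scale a (t : Qq) v : Eact a (scalev t v) = scalev t (Eact a v).
Proof.
apply: functional_extensionality => g; rewrite /Eact /scalev mulrDr.
by congr (_ + _); case: ifP => _; rewrite ?mulr0 //; apply: mulrCA.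
Qed.

(** * Exchanging neighbouring vertices of the diagram *)

Definition tau c x := if x == c then c + 1 else if x == c + 1 then c else x.
Definition shift c f : key m n := [ffun k => tau c (f k)].

Lemma tauK c : involutive (tau c).
Proof.
move=> x; rewrite /tau; case: (eqVneq x c) => [->|xc].
  by rewrite -subr_eq0 addrAC subrr /= eqxx.
by case: (eqVneq x (c + 1)) => [->|xd]; [rewrite eqxx | rewrite (negbTE xc) (negbTE xd)].
Qed.

Lemma shiftK c : involutive (shift c).
Proof. by move=> f; apply/ffunP => k; rewrite !ffunE tauK. Qed.

Lemma inpart_shift c f b x : inpart b (shift c f) x = inpart b f (tau c x).
Proof.
apply/inpartP/inpartP => -[k kb e]; exists k => //; first by rewrite -e ffunE tauK.
by rewrite ffunE e tauK.
Qed.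

Lemma sinj_shift c f : sinj f -> sinj (shift c f).
Proof. by move=> fi k l e; rewrite !ffunE => /(can_inj (tauK c)); apply: fi. Qed.

Lemma lone_shift c f k : lone (shift c f) k = lone f k.
Proof.
apply/loneP/loneP => H l e; apply: H; first by rewrite !ffunE e.
by move: e; rewrite !ffunE => /(can_inj (tauK c)).
Qed.

Lemma shift_swap c f i j : shift c (swap f i j) = swap (shift c f) i j.
Proof. by apply/ffunP => k; rewrite ffunE !swapE ffunE. Qed.

(** It is 0 at a circle, 1 at an arrow and 2 at a cross. *)
Definition cnt f c := (inpart true f c + inpart false f c)%N.

Lemma cntE f c : sinj f -> cnt f c = (\sum_k (f k == c))%N.
Proof.
move=> fi; have H b : (inpart b f c = \sum_(k | isneg k == b) (f k == c) :> nat)%N.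
  case: inpartP => [[k kb e]|ne].
    rewrite (bigD1 k) /=; last by rewrite kb.
    rewrite e eqxx big1 // => l /andP[/eqP lb lk]; apply/eqP; rewrite eqb0.
    by apply: contra lk => /eqP e2; apply/eqP/fi; rewrite ?kb ?e.
  rewrite big1 // => l /eqP lb; apply/eqP; rewrite eqb0.
  by apply/negP => /eqP e; apply: ne; exists l.
rewrite (bigID (fun k => isneg k)) /= /cnt !H.
by congr addn; apply: eq_bigl => k; case: (isneg k).
Qed.

Lemma cnt_swap f i j c : sinj f -> sinj (swap f i j) -> cnt (swap f i j) c = cnt f c.
Proof.
move=> fi si; rewrite !cntE // (reindex_inj (@perm_inj _ (tperm i j))).
by apply: eq_bigr => k _; rewrite swapE tpermK.
Qed.

(** Either an arrow has a circle on its right, or a cross has an arrow on its right. In both cases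
    exactly one term of the coproduct survives, and its coefficient is 1, since the exponent of [qq]
    vanishes when the second factor moves. *)
Lemma Fact_shift f c : sinj f -> cnt f c = (cnt f (c + 1)).+1 ->
  Fact c (Kvec (sortplus f)) = Kvec (sortplus (shift c f)).
Proof.
move=> fi; rewrite Fact_K // /cnt.
have nc : c != c + 1 by apply/eqP; lia.
have nc' : (c + 1 == c) = false by apply/negbTE; rewrite eq_sym.
have K b : inpart b f c -> ~~ inpart b f (c + 1) ->
   inpart (~~ b) f c = inpart (~~ b) f (c + 1) ->
   sortplus (repl b f c (c + 1)) = sortplus (shift c f).
  move=> h1 h2 e; apply: sortplus_ext; [exact: sinj_repl | exact: sinj_shift |].
  move=> b' z; rewrite inpart_repl // inpart_shift /tau.
  case: (eqVneq z (c + 1)) => [->|z1]; [rewrite nc' ?eqxx|case: (eqVneq z c) => [->|z0]];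
    case: (eqVneq b' b) => [->|bb] //; rewrite ?h1 ?(negbTE h2) //;
    by move: e bb; case: (b); case: b'.
have z v : addv v zerov = v by apply: functional_extensionality => g; rewrite /addv addr0.
have z' v : addv zerov v = v by apply: functional_extensionality => g; rewrite /addv add0r.
have s1 v : scalev 1 v = v by apply: functional_extensionality => g; rewrite /scalev mul1r.
have := K true; have := K false; rewrite /cpart.
case: (inpart true f c); case: (inpart true f (c + 1));
case: (inpart false f c); case: (inpart false f (c + 1)) => //= K1 K2 _; rewrite /guard /= ?z ?z'.
all: try by rewrite K2.
all: by rewrite subrr expr0z s1 K1.
Qed.

Lemma Eact_shift f c : sinj f -> cnt f (c + 1) = (cnt f c).+1 ->
  Eact c (Kvec (sortplus f)) = Kvec (sortplus (shift c f)).
Proof.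
move=> fi; rewrite Eact_K // /cnt.
have nc : c + 1 != c by apply/eqP; lia.
have K b : inpart b f (c + 1) -> ~~ inpart b f c ->
   inpart (~~ b) f c = inpart (~~ b) f (c + 1) ->
   sortplus (repl b f (c + 1) c) = sortplus (shift c f).
  move=> h1 h2 e; apply: sortplus_ext; [exact: sinj_repl | exact: sinj_shift |].
  move=> b' z; rewrite inpart_repl // inpart_shift /tau.
  case: (eqVneq z (c + 1)) => [->|z1]; [rewrite (negbTE nc) ?eqxx|case: (eqVneq z c) => [->|z0]];
    case: (eqVneq b' b) => [->|bb] //; rewrite ?h1 ?(negbTE h2) //;
    by move: e bb; case: (b); case: b'.
have z v : addv v zerov = v by apply: functional_extensionality => g; rewrite /addv addr0.
have z' v : addv zerov v = v by apply: functional_extensionality => g; rewrite /addv add0r.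
have s1 v : scalev 1 v = v by apply: functional_extensionality => g; rewrite /scalev mul1r.
have := K true; have := K false; rewrite /cpart.
case: (inpart true f c); case: (inpart true f (c + 1));
case: (inpart false f c); case: (inpart false f (c + 1)) => //= K1 K2 _; rewrite /guard /= ?z ?z'.
all: try by rewrite K1.
all: by rewrite subrr oppr0 expr0z s1 K2.
Qed.

(** From a cross followed by a circle, either half of the cross can move right. Moving the negative
    half gives a cup with adjacent ends; moving the positive half gives the flipped cup, and [K]
    contributes the factor [qq]. *)
Lemma Fact_cup f i j : sinj f -> isneg i -> ~~ isneg j -> f i = f j ->
  cnt f (f i + 1) = 0%N ->
  let f1 := [ffun k => if k == i then f i + 1 else f k] in
  Fact (f i) (Kvec (sortplus f)) =
  addv (Kvec (sortplus f1)) (scalev qq (Kvec (sortplus (swap f1 i j)))).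
Proof.
move=> fi ni nj e c0 f1; rewrite Fact_K //.
move/eqP: c0; rewrite /cnt addn_eq0 !eqb0 => /andP[t1 t2].
have it : inpart true f (f i) by apply/inpartP; exists i.
have jf : inpart false f (f i) by apply/inpartP; exists j; rewrite ?(negbTE nj).
have ij : i <> j by move=> e'; rewrite e' (negbTE nj) in ni.
have e1 : repl true f (f i) (f i + 1) = f1.
  apply/ffunP => k; rewrite !ffunE; case: (eqVneq k i) => [->|ki]; first by rewrite ni !eqxx.
  case: (boolP (isneg k)) => //= nk; case: eqVneq => // e'.
  by case/eqP: ki; apply: fi => //; rewrite nk ni.
have e2 : repl false f (f i) (f i + 1) = swap f1 i j.
  apply/ffunP => k; rewrite !ffunE eqxx; case: (eqVneq k i) => [->|ki].
    by rewrite ni /=; case: eqVneq ij => // ->.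
  case: (eqVneq k j) => [->|kj]; first by rewrite (negbTE nj) e ?eqxx /= ?eqxx.
  case: (boolP (isneg k)) => //= nk; case: eqVneq => // e'.
  by case/eqP: kj; apply: fi; rewrite ?e' // (negbTE nk) (negbTE nj).
rewrite e1 e2 it jf t1 t2 /guard /=; congr addv; congr scalev.
by rewrite /cpart it (negbTE t1) /= subr0 expr1z.
Qed.

End Act.

(** * Cup vectors *)

Section Cup.
Variables m n : nat.
Implicit Types (f g h : key m n) (i j k l : 'I_(m + n)) (b : bool) (a c x y : int).
Implicit Types (p q : 'I_(m + n) * 'I_(m + n)) (u v : vec m n).
Implicit Types (cs : seq ('I_(m + n) * 'I_(m + n))) (A : pred 'I_(m + n)).

(** The product of the factors 1 + q flip. For the cups of [f] it is [W f]; the other lists arise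
    when cups are removed during the induction. *)
Fixpoint cupvec f cs : vec m n :=
  if cs is p :: cs' then addv (cupvec f cs') (scalev qq (cupvec (swap f p.1 p.2) cs'))
  else Kvec (sortplus f).

(** The order of the two ends is left open, so that the notion survives flips. *)
Definition is_cup f p := [&& isneg p.1, ~~ isneg p.2, lone f p.1 & lone f p.2].
Definition disj p q := (p.1 != q.1) && (p.2 != q.2).
Definition disjs cs := uniq (map fst cs) && uniq (map snd cs).
Definition cups_ok f cs := [/\ sinj f, all (is_cup f) cs & disjs cs].

Lemma disjs_cons p cs : disjs (p :: cs) = all (disj p) cs && disjs cs.
Proof.
have -> : all (disj p) cs = (p.1 \notin map fst cs) && (p.2 \notin map snd cs).
  by elim: cs => //= q cs ->; rewrite !inE !negb_or /disj andbACA.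
by rewrite /disjs /= andbACA.
Qed.


Lemma disj_sides f p q : is_cup f p -> is_cup f q -> disj p q ->
  [/\ p.1 != q.1, p.1 != q.2, p.2 != q.1 & p.2 != q.2].
Proof.
move=> /and4P[a1 a2 _ _] /and4P[b1 b2 _ _] /andP[-> ->]; split=> //.
  by apply: contraTneq a1 => ->.
by apply: contraNneq a2 => ->.
Qed.

Lemma is_cup_swap f p q : is_cup f p -> disj q p -> is_cup f q -> is_cup (swap f p.1 p.2) q.
Proof.
move=> hp dq hq; have [n1 n2 n3 n4] := disj_sides hq hp dq.
by move: hq; rewrite /is_cup !lone_swap !tpermD // eq_sym.
Qed.

Lemma disjC p q : disj p q = disj q p.
Proof. by rewrite /disj ![p.1 == _]eq_sym ![p.2 == _]eq_sym. Qed.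

Lemma cups_ok_cons f p cs : cups_ok f (p :: cs) ->
  [/\ is_cup f p, all (disj p) cs, cups_ok f cs & cups_ok (swap f p.1 p.2) cs].
Proof.
case=> fi /= /andP[hp hc]; rewrite disjs_cons => /andP[dp dc]; split=> //.
have /and4P[_ _ l1 l2] := hp.
split=> //; first exact: sinj_swap.
apply/allP => q hq; apply: is_cup_swap => //; last exact: (allP hc).
by rewrite disjC (allP dp).
Qed.

Lemma cupvec_swap2 f p q : is_cup f p -> is_cup f q -> disj p q ->
  swap (swap f p.1 p.2) q.1 q.2 = swap (swap f q.1 q.2) p.1 p.2.
Proof. by move=> hp hq d; have [n1 n2 n3 n4] := disj_sides hp hq d; apply: swapC. Qed.

Lemma addvA u v (w : vec m n) : addv u (addv v w) = addv (addv u v) w.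
Proof. by apply: functional_extensionality => g; rewrite /addv addrA. Qed.
Lemma addvC u v : addv u v = addv v u.
Proof. by apply: functional_extensionality => g; rewrite /addv addrC. Qed.
Lemma scalevD t u v : scalev t (addv u v) = addv (scalev t u) (scalev t v).
Proof. by apply: functional_extensionality => g; rewrite /scalev /addv mulrDr. Qed.

Lemma cupvec_head f p q cs : cups_ok f [:: p, q & cs] ->
  cupvec f [:: p, q & cs] = cupvec f [:: q, p & cs].
Proof.
move=> H; have [hp /= /andP[d _] H' _] := cups_ok_cons H.
have [hq _ _ _] := cups_ok_cons H'.
rewrite /= !scalevD (cupvec_swap2 hp hq d) -!addvA; congr addv.
by rewrite !addvA; congr addv; rewrite addvC.
Qed.

Lemma cups_ok_perm f cs cs' : perm_eq cs cs' -> cups_ok f cs -> cups_ok f cs'.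
Proof.
move=> e [fi a d]; split=> //; first by rewrite -(perm_all _ e).
by move: d; rewrite /disjs !(perm_uniq (perm_map _ e)).
Qed.

Lemma cupvec_rot f cs1 p cs2 : cups_ok f (cs1 ++ p :: cs2) ->
  cupvec f (cs1 ++ p :: cs2) = cupvec f (p :: cs1 ++ cs2).
Proof.
elim: cs1 f => // q cs1 IH f H.
rewrite [RHS]cupvec_head; last first.
  by apply: cups_ok_perm H; rewrite -(cat1s p cs2) perm_catCA.
have [_ _ H1 H2] := cups_ok_cons H.
by rewrite /= (IH _ H1) (IH _ H2).
Qed.

(** Disjoint flips commute. This reconciles the list of cups by length, suited to bar invariance,
    with the list by particles, suited to the operators. *)
Lemma cupvec_perm f cs cs' : perm_eq cs cs' -> cups_ok f cs -> cupvec f cs = cupvec f cs'.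
Proof.
elim: cs cs' f => [|p cs IH] cs' f e H.
  by move/perm_size: e; case: cs'.
have pin : p \in cs' by rewrite -(perm_mem e) mem_head.
have H' := cups_ok_perm e H.
case/splitPr: pin e H' => c1 c2 e H'; rewrite cupvec_rot // /=.
have e' : perm_eq cs (c1 ++ c2).
  by rewrite -(perm_cons p) (perm_trans e) // -(cat1s p c2) perm_catCA.
have [_ _ H1 H2] := cups_ok_cons H.
by rewrite (IH _ _ e' H1) (IH _ _ e' H2).
Qed.

(** Flips permute the entries, so [cnt] is the same for every term and [Fact_shift] applies to each
    of them. *)
Lemma Fact_cupvec f c cs : cups_ok f cs -> cnt f c = (cnt f (c + 1)).+1 ->
  Fact c (cupvec f cs) = cupvec (shift c f) cs.
Proof.
elim: cs f => [|p cs IH] f H e; first by apply: Fact_shift e; case: H.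
have [/and4P[_ _ l1 l2] _ H1 H2] := cups_ok_cons H; have fi : sinj f by case: H.
rewrite /= Fact_add Fact_scale IH // IH ?shift_swap //.
by rewrite !cnt_swap //; apply: sinj_swap.
Qed.

Lemma Eact_cupvec f c cs : cups_ok f cs -> cnt f (c + 1) = (cnt f c).+1 ->
  Eact c (cupvec f cs) = cupvec (shift c f) cs.
Proof.
elim: cs f => [|p cs IH] f H e; first by apply: Eact_shift e; case: H.
have [/and4P[_ _ l1 l2] _ H1 H2] := cups_ok_cons H; have fi : sinj f by case: H.
rewrite /= Eact_add Eact_scale IH // IH ?shift_swap //.
by rewrite !cnt_swap //; apply: sinj_swap.
Qed.

Lemma Fact_cupvec_cup f i j cs : cups_ok f cs -> isneg i -> ~~ isneg j -> f i = f j ->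
  cnt f (f i + 1) = 0%N ->
  let f1 := [ffun k => if k == i then f i + 1 else f k] in
  Fact (f i) (cupvec f cs) = cupvec f1 ((i, j) :: cs).
Proof.
move=> H ni nj e; elim: cs f H e => [|p cs IH] f H e c0 f1.
  by apply: Fact_cup => //; case: H.
have [hp _ H1 H2] := cups_ok_cons H; have fi : sinj f by case: H.
have /and4P[n1 n2 /loneP l1 /loneP l2] := hp.
have ij : i != j by apply: contraTneq ni => ->.
(* The ends of [p] are arrows, whereas [i] and [j] form a cross; hence the flip of [p] leaves both
   in place. *)
have i1 : i != p.1.
  by apply/eqP => ep; move: (l1 j); rewrite -ep -e => /(_ erefl) ji; rewrite ji eqxx in ij.
have j2 : j != p.2.
  by apply/eqP => ep; move: (l2 i); rewrite -ep -e => /(_ erefl) ji; rewrite ji eqxx in ij.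
have i2 : i != p.2 by apply: contraNneq n2 => <-.
have j1 : j != p.1 by apply: contraNneq nj => ->.
set f' := swap f p.1 p.2.
have fi' : f' i = f i by rewrite swap_id.
have fj' : f' j = f j by rewrite swap_id.
have e' : f' i = f' j by rewrite fi' fj'.
have e1 : [ffun k => if k == i then f i + 1 else f' k] = swap f1 p.1 p.2.
  apply/ffunP => k; rewrite ffunE !swapE /f1 ffunE.
  case: (eqVneq k i) => [->|ki]; first by rewrite tpermD 1?eq_sym // eqxx.
  case: tpermP => [_|_|_ _]; first by rewrite eq_sym (negbTE i2).
    by rewrite eq_sym (negbTE i1).
  by rewrite (negbTE ki).
have c0' : cnt f' (f' i + 1) = 0%N.
  rewrite fi' cnt_swap //; apply: sinj_swap => //; exact/loneP.
have EH := IH f' H2 e' c0'; rewrite /= fi' in EH.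
rewrite /= Fact_add Fact_scale (IH f H1 e c0) EH e1 /=.
rewrite -/f1 !scalevD -!addvA; congr addv; rewrite !addvA; congr addv.
  by rewrite addvC.
by congr scalev; congr scalev; congr cupvec; rewrite swapC // eq_sym.
Qed.

(* [cs] is a complete cup diagram on the arrows in [A], with inner cups listed
   before outer ones. *)
Fixpoint nested A f cs : Prop :=
  if cs is p :: cs' then
    [/\ A p.1, A p.2, isneg p.1 && ~~ isneg p.2,
        f p.2 < f p.1 /\ (forall k, A k -> f p.2 < f k -> f k < f p.1 -> False)
      & nested (fun k => [&& A k, k != p.1 & k != p.2]) f cs']
  else forall i j, A i -> A j -> isneg i -> ~~ isneg j -> f i < f j.

(** Only the relative order of the arrows matters, so a slide past a circle or a cross preserves the
    diagram. *)
Lemma nested_ext A A' f f' cs : A =1 A' ->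
  (forall k l, A k -> A l -> (f k < f l) = (f' k < f' l)) -> nested A f cs -> nested A' f' cs.
Proof.
elim: cs A A' => [|p cs IH] A A' eA ef /=.
  by move=> H i j; rewrite -!eA => Ai Aj; rewrite -ef //; apply: H.
case=> a1 a2 s [lt it] ne; split=> //; rewrite -?eA //.
  split; first by rewrite -ef.
  by move=> k; rewrite -eA => Ak; rewrite -!ef //; apply: it.
apply: IH ne; first by move=> k; rewrite eA.
by move=> k l /and3P[Ak _ _] /and3P[Al _ _]; apply: ef.
Qed.

Lemma nested_cups A f f' cs : sinj f -> (forall k, A k -> lone f k) ->
  nested A f' cs -> cups_ok f cs /\ (forall p, p \in cs -> A p.1 && A p.2).
Proof.
move=> fi; elim: cs A => [|p cs IH] A Al /=; first by split=> //; split.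
case=> a1 a2 /andP[n1 n2] _ ne.
have [|[_ H1 H2] H3] := IH _ _ ne; first by move=> k /and3P[/Al].
split.
  split=> //=; first by rewrite H1 /is_cup n1 n2 !Al.
  rewrite disjs_cons H2 andbT; apply/allP => q /H3 /andP[/and3P[_ q1 _] /and3P[_ _ q2]].
  by rewrite disjC /disj q1 q2.
move=> q; rewrite inE => /orP[/eqP ->|/H3]; first by rewrite a1 a2.
by case/andP => /and3P[-> _ _] /and3P[-> _ _].
Qed.

Lemma Kvec_isvec f : inZplus f -> isvec (Kvec f).
Proof.
move=> fd; exists [:: f]; rewrite /= fd; split=> // g; rewrite inE /Kvec => /negbTE -> //.
Qed.

Lemma addv_isvec u v : isvec u -> isvec v -> isvec (addv u v).
Proof.
move=> [s [sd sv]] [t [td tv]]; exists (s ++ t); rewrite all_cat sd td; split=> // g.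
by rewrite mem_cat => /norP[gs gt]; rewrite /addv sv // tv // addr0.
Qed.

Lemma scalev_isvec t u : isvec u -> isvec (scalev t u).
Proof. by move=> [s [sd sv]]; exists s; split=> // g gs; rewrite /scalev sv // mulr0. Qed.

Lemma cupvec_isvec f cs : cups_ok f cs -> isvec (cupvec f cs).
Proof.
elim: cs f => [|p cs IH] f H /=; first by apply/Kvec_isvec/sortplus_inZplus; case: H.
have [_ _ H1 H2] := cups_ok_cons H.
by apply: addv_isvec; [apply: IH | apply/scalev_isvec/IH].
Qed.

End Cup.

(** * Bar invariance *)

Section Bar.
Variables m n : nat.
Implicit Types (f g h : key m n) (i j k l : 'I_(m + n)) (b : bool) (a c x y : int).
Implicit Types (p q : 'I_(m + n) * 'I_(m + n)) (u v : vec m n).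
Implicit Types (cs : seq ('I_(m + n) * 'I_(m + n))) (A : pred 'I_(m + n)).

Definition len f p := f p.1 - f p.2.

(** Cups are produced by increasing length, which places inner cups before outer ones. *)
Lemma sigma_len f K : pairwise (fun p q => len f p <= len f q) (sigma_upto f K).
Proof.
elim: K => //= K IH; rewrite pairwise_cat IH /=; set s := filter _ _.
have sl p : p \in s -> len f p = K.+1.
  by rewrite mem_filter => /andP[/and3P[_ /eqP]].
apply/andP; split.
  apply/allrelP => p q /sigma_atyp /andP[_ pK] /sl ->.
  by apply: le_trans pK _; rewrite lez_nat.
elim: s sl => //= p s IHs sl; rewrite IHs; last by move=> q qs; rewrite sl // inE qs orbT.
rewrite andbT; apply/allP => q qs.
by rewrite (sl p (mem_head _ _)) (sl q) // inE qs orbT.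
Qed.

Definition width f := (\max_p absz (len f p))%N.
Definition cups f := sigma_upto f (width f).

Lemma mem_cups f p : (p \in cups f) = inSigmaPlus f p.1 p.2.
Proof.
apply: mem_sigma; rewrite -/(len f p).
apply: le_trans (lez_abs _) _; rewrite abszE lez_nat.
exact: (leq_bigmax (F := fun p => absz (len f p)) p).
Qed.

Lemma nested_cups_of f : sinj f -> nested (lone f) f (cups f).
Proof.
move=> fi.
(* Generalized to a final segment of the list; the active arrows are those that are not ends of cups
   in [pre]. *)
suff H pre cs : cups f = pre ++ cs ->
    nested (fun k => lone f k && all (fun p => (k != p.1) && (k != p.2)) pre) f cs.
  by apply: nested_ext (H [::] _ erefl) => // k /=; rewrite andbT.
elim: cs pre => [|p cs IH] pre e.
  (* A remaining pair in cup position would be atypical, hence share an end with some cup, but all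
     ends of cups have been removed. *)
  rewrite cats0 in e => i j /andP[li ai] /andP[lj aj] ni nj; rewrite ltNge.
  apply/negP => ji.
  have ij : f j < f i.
    rewrite lt_neqAle ji andbT; apply: contraTneq ni => e'.
    by rewrite ((loneP _ _ lj) i (esym e')).
  have [p [Mp e' _]] : exists p, [/\ inSigmaPlus f p.1 p.2, p.1 = i \/ p.2 = j & f p.1 - f p.2 <= f i - f j].
    by apply: inSigma_max; rewrite atypE // ni nj ij li lj.
  have pp : p \in pre by rewrite -e mem_cups.
  have /andP[p1 _] := allP ai _ pp; have /andP[_ p2] := allP aj _ pp.
  by case: e' => e'; rewrite e' eqxx in p1 p2.
have pc : p \in cups f by rewrite e mem_cat mem_head orbT.
have u : uniq (cups f) := sigma_uniq _ _.
have M : inSigmaPlus f p.1 p.2 by rewrite -mem_cups.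
move: (inSigma_atyp M); rewrite atypE // => /and5P[n1 n2 lt l1 l2].
have np q : q \in pre -> (q.1 != p.1) && (q.2 != p.2).
  move=> qp; have qp' : q != p.
    move: u; rewrite e cat_uniq /= negb_or => /and3P[_ /andP[pp _] _].
    by apply: contraTneq qp => ->.
  have Mq : inSigmaPlus f q.1 q.2 by rewrite -mem_cups e mem_cat qp.
  by apply/andP; split; apply: contra qp' => /eqP e'; apply/eqP; apply: (inSigma_uniq fi Mq M); auto.
have nq q : q \in pre -> is_cup f q.
  move=> qp; have : inSigmaPlus f q.1 q.2 by rewrite -mem_cups e mem_cat qp.
  by move/inSigma_atyp; rewrite atypE // /is_cup => /and5P[-> -> _ -> ->].
split=> /=.
- rewrite l1; apply/allP => q qp; have /andP[d1 _] := np q qp; rewrite eq_sym d1 /=.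
  by have /and4P[_ q2 _ _] := nq q qp; apply: contraTneq n1 => ->.
- rewrite l2; apply/allP => q qp; have /andP[_ d2] := np q qp; rewrite (eq_sym p.2 q.2) d2 andbT.
  by have /and4P[q1 _ _ _] := nq q qp; apply: contraNneq n2 => ->.
- by rewrite n1.
- split=> // k /andP[lk ak] jk ki.
  have [q [Mq eq h1 h2 h3]] := inSigma_inner fi M lk jk ki.
  have : q \in cups f by rewrite mem_cups.
  rewrite e mem_cat => /orP[qp|].
    by have /andP[] := allP ak _ qp; rewrite {1 2}eq; case: (isneg k); rewrite eqxx.
  rewrite inE => /orP[/eqP eqp|qc]; first by rewrite eqp ltxx in h1.
  (* The cup of an arrow strictly under [p] is strictly shorter than [p], so it cannot come after
     [p] in the list. *)
  have := sigma_len f (width f); rewrite -/(cups f) e pairwise_cat => /and3P[_ _ /=].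
  case/andP => /allP/(_ _ qc); rewrite /len leNgt => /negP[].
  by apply: ltrB.
have e2 : cups f = rcons pre p ++ cs by rewrite e cat_rcons.
apply: nested_ext (IH _ e2) => // k /=.
by rewrite all_rcons /=; case: (lone f k) => //=; rewrite andbC.
Qed.

(** * Invariants and monotone quantities of the Bruhat ordering *)

Definition mult f c := (\sum_k (f k == c))%N.
Definition above t f := (\sum_(k | isneg k) (t <= f k)%R)%N.
(** A step up moves the larger entry to an earlier position, so this sum strictly decreases and
    rules out cycles. *)
Definition height f : int := \sum_(k < m + n) (k : nat)%:Z * f k.

Lemma bigswap (R : Type) (idx : R) (op : Monoid.com_law idx) i j (F : 'I_(m + n) -> R) : i != j ->
  \big[op/idx]_k F k = op (op (F i) (F j)) (\big[op/idx]_(k | (k != i) && (k != j)) F k).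
Proof. by move=> ij; rewrite (bigD1 i) //= (bigD1 j) 1?eq_sym //= Monoid.mulmA. Qed.

Lemma bruhat_mult f g c : bruhat_lt f g -> mult f c = mult g c.
Proof.
elim=> {f g} [f g [i [j [ij [fij ->]]]]|f h g _ -> _ ->] //.
rewrite /mult (reindex_inj (@perm_inj _ (tperm i j))) /=.
by apply: eq_bigr => k _; rewrite swapE.
Qed.

Lemma bruhat_height f g : bruhat_lt f g -> height g < height f.
Proof.
elim=> {f g} [f g [i [j [ij [fij ->]]]]|f h g _ H _ H']; last exact: lt_trans H' H.
have nij : i != j by apply: contraTneq ij => ->; rewrite ltnn.
rewrite /height !(@bigswap _ _ _ i j) //= swapL swapR.
rewrite (eq_bigr (fun k : 'I_(m + n) => (k : nat)%:Z * f k)); last first.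
  by move=> k /andP[ki kj]; rewrite swap_id.
by rewrite ltrD2r; nia.
Qed.

Lemma bruhat_above f g t : bruhat_lt f g -> (above t f <= above t g)%N.
Proof.
elim=> {f g} [f g [i [j [ij [fij ->]]]]|f h g _ H _ H']; last exact: leq_trans H H'.
have nij : i != j by apply: contraTneq ij => ->; rewrite ltnn.
rewrite /above !(big_mkcond (fun k => isneg k)) /= !(@bigswap _ _ _ i j) //= swapL swapR.
set r := (\sum_(_ | _) _)%N; set r' := (\sum_(_ | _) _)%N.
have -> : r' = r by apply: eq_bigr => k /andP[ki kj]; rewrite swap_id.
rewrite leq_add2r.
have : isneg j -> isneg i by rewrite /isneg; exact: ltn_trans.
have : (t <= f i) ==> (t <= f j) by apply/implyP => h; apply: le_trans h (ltW fij).
by case: (isneg i); case: (isneg j); case: (t <= f i); case: (t <= f j) => //= _ /(_ isT).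
Qed.

Lemma mult_cnt f c : sinj f -> mult f c = cnt f c.
Proof. by move=> fi; rewrite cntE. Qed.

(** Without cups every down arrow is left of every up arrow. Let [g] be below the sorted key [h].
    Equal negative entries would give [g = h], against [bruhat_height]. Otherwise some [y] is
    negative in [g] but an up arrow of [h]; the negative entries of [h] beyond [y] belong to crosses
    and stay negative in [g], so [above y] is larger for [g], against [bruhat_above]. *)
Lemma cupless_minimal f : sinj f -> nested (lone f) f [::] -> bruhat_minimal (sortplus f).
Proof.
move=> fi ne [g [gd lt]].
have hd := sortplus_inZplus fi; set h := sortplus f in lt hd.
have hs : sameset h f by exact: sortplus_sameset.
have gi := inZplus_sinj gd; have hi := inZplus_sinj hd.
have ec c : cnt g c = cnt h c by rewrite -!mult_cnt // (bruhat_mult c lt).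
have pure x y : inpart true h x -> ~~ inpart false h x -> inpart false h y -> ~~ inpart true h y -> x < y.
  rewrite !hs => /inpartP[i ni <-] hx /inpartP[j nj <-] hy.
  by apply: ne; rewrite ?lone_inpart // ?ni ?nj.
case: (boolP (all (fun y => inpart true h y) (vals true g))) => [/allP sub|].
  have sub' : {subset vals true g <= vals true h} by move=> y; rewrite [y \in vals _ h]mem_vals => /sub.
  have [_ e] := uniq_min_size (uniq_vals true gi) sub' (eq_leq (etrans (size_vals _ _) (esym (size_vals _ _)))).
  have et y : inpart true g y = inpart true h y by rewrite -!mem_vals e.
  have eg : g = h.
    apply: inZplus_ext => // b y; case: b => //; have := ec y; rewrite /cnt et => /addnI.
    by case: (inpart false g y); case: (inpart false h y).
  by have := bruhat_height lt; rewrite eg ltxx.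
case/allPn => y; rewrite mem_vals => yg yh.
have yf : inpart false h y.
  by have := ec y; rewrite /cnt yg (negbTE yh); case: (inpart false h y).
have szE (k : key m n) : size [seq x <- vals true k | y <= x] = above y k.
  rewrite size_filter /vals count_map -sum1_count big_filter_cond.
  rewrite /above big_mkcond [RHS]big_mkcond big_enum /=.
  by apply: eq_bigr => i _; rewrite eqb_id; case: (isneg i) => //=; case: (y <= k i).
have := bruhat_above y lt; rewrite -!szE leqNgt => /negP[].
apply: (@uniq_leq_size _ (y :: [seq x <- vals true h | y <= x])).
  by rewrite /= mem_filter mem_vals (negbTE yh) andbF filter_uniq ?uniq_vals.
move=> x; rewrite inE mem_filter mem_filter !mem_vals => /orP[/eqP ->|/andP[yx xh]].
  by rewrite lexx.
rewrite yx /=; have := ec x; rewrite /cnt xh.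
case: (boolP (inpart false h x)) => xf; last by have := pure x y xh xf yf yh; rewrite ltNge yx.
by case: (inpart true g x); case: (inpart false g x).
Qed.

(** Induction on the number of cups, and inside it on the length of the first cup, which is
    innermost. Each step writes the vector as the image of an earlier one under some [Eact] or
    [Fact]. *)
Lemma bar_cupvec barF psi f cs : is_bar_involution barF psi -> sinj f ->
  nested (lone f) f cs -> psi (cupvec f cs) = cupvec f cs.
Proof.
move=> [_ _ _ bE bF _ _ bM _]; elim: cs f => [|p cs IH] f fi ne.
  by apply: bM; [exact: sortplus_inZplus | exact: cupless_minimal].
have : exists d : nat, len f p = d.+1.
  by case: ne => _ _ _ [lt _] _; exists (absz (len f p)).-1; rewrite /len; lia.
case=> d; elim: d f fi ne => [|d IHd] f fi ne dE.
  case: p ne dE => i j /= [li lj /andP[ni nj] [lt it] ne] dE; rewrite /len /= in dE.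
  have fij : f i = f j + 1 by move: dE; clear; lia.
  have ij : i != j by apply: contraTneq ni => ->.
  (* Adjacent ends: [f'] has a cross at [f j] and a circle at [f i] in place of the cup. *)
  pose f' : key m n := [ffun k => if k == i then f j else f k].
  have f'i : f' i = f j by rewrite ffunE eqxx.
  have f'j : f' j = f j by rewrite ffunE eq_sym (negbTE ij).
  have f'k k : k != i -> f' k = f k by rewrite ffunE => /negbTE ->.
  have f'fi : sinj f'.
    move=> k l e; case: (eqVneq k i) => [ek|ki]; case: (eqVneq l i) => [el|kl].
    - by rewrite ek el.
    - rewrite ek f'i f'k // => e'; have := (loneP _ _ lj) l (esym e') => lj'.
      by rewrite -lj' -e ek ni in nj.
    - rewrite el f'i f'k // => e'; have := (loneP _ _ lj) k e' => lj'.
      by rewrite -lj' e el ni in nj.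
    by rewrite !f'k //; apply: fi.
  have loneE k : [&& lone f k, k != i & k != j] = lone f' k.
    apply/and3P/loneP => [[/loneP lk ki kj] l|H].
      rewrite (f'k k) //; case: (eqVneq l i) => [->|li'].
        by rewrite f'i => e; move: kj; rewrite ((loneP _ _ lj) k (esym e)) eqxx.
      by rewrite f'k //; apply: lk.
    have ki : k != i.
      by apply/eqP => ek; have := H j; rewrite ek f'i f'j => /(_ erefl) e; rewrite e eqxx in ij.
    have kj : k != j.
      by apply/eqP => ek; have := H i; rewrite ek f'i f'j => /(_ erefl) e; rewrite e eqxx in ij.
    split=> //; apply/loneP => l; rewrite -[f k]f'k //.
    case: (eqVneq l i) => [->|li' e].
      by rewrite f'k // => e; move: ki; rewrite ((loneP _ _ li) k (esym e)) eqxx.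
    by apply: H; rewrite f'k.
  have ne' : nested (lone f') f' cs.
    apply: nested_ext ne => // k l /and3P[_ ki _] /and3P[_ li' _].
    by rewrite !f'k.
  have [ok _] := nested_cups f'fi (fun k (H : lone f' k) => H) ne'.
  have c0 : cnt f' (f' i + 1) = 0%N.
    apply/eqP; rewrite /cnt addn_eq0 !eqb0.
    suff H b : ~~ inpart b f' (f' i + 1) by rewrite !H.
    apply/negP => /inpartP[k _]; rewrite f'i -fij; case: (eqVneq k i) => [->|ki].
      by rewrite f'i => e; move: lt; rewrite e ltxx.
    by rewrite f'k // => e; move: ki; rewrite ((loneP _ _ li) k e) eqxx.
  have f1E : [ffun k => if k == i then f' i + 1 else f' k] = f.
    by apply/ffunP => k; rewrite f'i !ffunE; case: eqVneq => // ->.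
  have := @Fact_cupvec_cup m n f' i j cs ok ni nj (etrans f'i (esym f'j)) c0.
  rewrite /= f1E => <-; rewrite bF ?IH //.
  exact: cupvec_isvec.
(* The right end of the cup is slid left to [c]. The cup is innermost and longer than 1, so [c]
   carries a circle or a cross. *)
set c := f p.1 - 1; have [l1 l2 /andP[n1 n2] [lt it] ne'] := ne.
have c1 : f p.1 = c + 1 by rewrite /c subrK.
have jc : f p.2 < c by move: dE c1; rewrite /len; clear; lia.
have cc : c < f p.1 by rewrite c1; clear; lia.
have narrow k : f k = c -> ~~ lone f k.
  by move=> e; apply/negP => lk; apply: (it k lk); rewrite e.
have lone_c1 k : f k = c + 1 -> k = p.1 by rewrite -c1; apply/loneP.
have tauE k : lone f k -> tau c (f k) = if k == p.1 then c else f k.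
  move=> lk; rewrite /tau; case: (eqVneq k p.1) => [->|kp].
    by rewrite c1 eqxx; case: eqVneq => // e; move: cc; rewrite c1 e ltxx.
  case: (eqVneq (f k) c) => [/narrow|_]; first by rewrite lk.
  by case: eqVneq => // /lone_c1 e; rewrite e eqxx in kp.
pose f' := shift c f.
have f'fi : sinj f' by exact: sinj_shift.
have f'ne : nested (lone f') f' (p :: cs).
  apply: nested_ext ne => [k|k l lk ll]; first by rewrite lone_shift.
  have kc : f k != c by apply: contraTneq lk => /narrow.
  have lc : f l != c by apply: contraTneq ll => /narrow.
  rewrite !ffunE !tauE //; case: (eqVneq k p.1) => [->|kp]; case: (eqVneq l p.1) => [->|lp]; rewrite ?ltxx //.
    have : f l != c + 1 by apply: contra lp => /eqP/lone_c1 ->.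
    by move: lc; rewrite c1; clear; lia.
  by move: kc; rewrite c1; clear; lia.
have dE' : len f' p = d.+1.
  rewrite /len !ffunE !tauE // eqxx; move: dE; rewrite /len.
  have -> : (p.2 == p.1) = false by apply: contraNF n2 => /eqP ->.
  by rewrite /c; clear; lia.
have eqW := IHd f' f'fi f'ne dE'.
have [ok _] := nested_cups f'fi (fun k (H : lone f' k) => H) f'ne.
have iv := cupvec_isvec ok.
have t1 : tau c c = c + 1 by rewrite /tau eqxx.
have t2 : tau c (c + 1) = c by rewrite -t1 tauK.
have p1 : cnt f (c + 1) = 1%N.
  rewrite /cnt -c1; have -> : inpart true f (f p.1) by apply/inpartP; exists p.1.
  by have := l1; rewrite lone_inpart // n1 /= => /negbTE ->.
have c02 : cnt f c = 0%N \/ cnt f c = 2%N.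
  have H b : inpart b f c -> inpart (~~ b) f c.
    by case/inpartP => k kb kc; have := narrow k kc; rewrite lone_inpart // kb kc negbK.
  rewrite /cnt; have := H true; have := H false.
  by case: (inpart true f c); case: (inpart false f c) => /= h1 h2;
    [right | have := h2 isT | have := h1 isT | left].
have e1 : cnt f' c = 1%N by rewrite /cnt !inpart_shift t1.
have e2 : cnt f' (c + 1) = cnt f c by rewrite /cnt !inpart_shift t2.
have fE : shift c f' = f by exact: shiftK.
(* Past a circle the arrow is moved back by [Fact]; past a cross, by [Eact]. *)
case: c02 => c02; rewrite c02 in e2.
  have := @Fact_cupvec m n f' c (p :: cs) ok; rewrite e1 e2 fE => /(_ erefl) <-.
  by rewrite bF // eqW.
have := @Eact_cupvec m n f' c (p :: cs) ok; rewrite e1 e2 fE => /(_ erefl) <-.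
by rewrite bE // eqW.
Qed.

End Bar.

(** * Uniqueness *)

Section Scalars.
Implicit Types (p r : {poly int}) (x y : Qq).

Definition evalq (y : Qq) p : Qq := (map_poly (fun z : int => z%:~R) p).[y].

Lemma evalq_wide y p d : (size p <= d)%N -> evalq y p = \sum_(i < d) (p`_i)%:~R * y ^+ i.
Proof.
move=> sp; rewrite /evalq (horner_coef_wide (n := d)).
  by apply: eq_bigr => i _; rewrite coef_map_id0 ?mulr0z.
exact: leq_trans (size_poly _ _) sp.
Qed.

Lemma evalqD y p r : evalq y (p + r) = evalq y p + evalq y r.
Proof. by rewrite /evalq (rmorphD (map_poly (intr : int -> Qq))) hornerD. Qed.
Lemma evalqN y p : evalq y (- p) = - evalq y p.
Proof. by rewrite /evalq (rmorphN (map_poly (intr : int -> Qq))) hornerN. Qed.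
Lemma evalqXM y p d : evalq y ('X^d * p) = y ^+ d * evalq y p.
Proof.
rewrite /evalq (rmorphM (map_poly (intr : int -> Qq))) hornerM /=.
by rewrite map_polyXn hornerXn.
Qed.

(** [qq] is transcendental: evaluation at it is the embedding of polynomials into their fraction
    field. *)
Lemma evalq_qq_eq0 p : evalq qq p = 0 -> p = 0.
Proof.
move=> H; have E : evalq qq p = tofrac (map_poly (intr : int -> rat) p).
  rewrite (@evalq_wide _ _ (size p)) // -[map_poly _ _]coefK poly_def rmorph_sum /=.
  rewrite size_map_inj_poly ?rmorph0 //; last exact: intr_inj.
  apply: eq_bigr => i _; rewrite coef_map /= -mul_polyC rmorphM rmorphXn /=.
  by rewrite -[(_%:~R)%:P]/(polyC (intr _)) !rmorph_int.
move: H; rewrite E => /eqP; rewrite tofrac_eq0 => /eqP H.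
apply/polyP => i; rewrite coef0; apply: (@intr_inj rat).
by rewrite -[LHS](coef_map (intr : int -> rat)) H coef0.
Qed.

Lemma qq_neq0 : qq != 0.
Proof. by rewrite /qq tofrac_eq0 polyX_eq0. Qed.

(** Multiplying the invariance of q p(q) by a power of q gives [r] = X^(d+2) p, where [r] is [p]
    reversed in degree [d]. Since [r] has no terms beyond degree [d], all coefficients of [p]
    vanish. *)
Lemma bar_inqZq (barF : {rmorphism Qq -> Qq}) x : barF qq = qq^-1 ->
  inqZq x -> barF x = x -> x = 0.
Proof.
move=> bq [p ->]; rewrite -/(evalq qq p) => H.
suff -> : p = 0 by rewrite /evalq map_poly0 horner0 mulr0.
pose d := size p; pose r := \poly_(k < d.+1) p`_(d - k).
have bp : barF (evalq qq p) = evalq qq^-1 p.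
  rewrite !(@evalq_wide _ _ d) // rmorph_sum; apply: eq_bigr => i _.
  by rewrite rmorphM rmorph_int rmorphXn /= bq.
have er : evalq qq r = qq ^+ d * evalq qq^-1 p.
  rewrite (@evalq_wide _ r d.+1) ?size_poly // (@evalq_wide _ p d.+1) // mulr_sumr.
  rewrite (reindex_inj rev_ord_inj) /=; apply: eq_bigr => i _.
  rewrite coef_poly subSS; have id : (i <= d)%N by rewrite -ltnS.
  rewrite ltnS leq_subr subKn // mulrCA; congr (_ * _).
  have -> : qq ^+ d = qq ^+ (d - i) * qq ^+ i by rewrite -exprD subnK.
  by rewrite exprVn mulfK // expf_neq0 // qq_neq0.
have e0 : evalq qq (r + - ('X^(d.+2) * p)) = 0.
  rewrite evalqD evalqN evalqXM er; move: H; rewrite rmorphM bq bp => H.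
  have -> : qq ^+ d.+2 * evalq qq p = qq ^+ d.+1 * (qq * evalq qq p) by rewrite exprSr mulrA.
  by rewrite -H mulrA exprSr mulfK ?qq_neq0 // subrr.
have /eqP := evalq_qq_eq0 e0; rewrite subr_eq0 => /eqP er'.
apply/polyP => i; rewrite coef0; have := congr1 (fun t : {poly int} => t`_(d.+2 + i)) er'.
rewrite coefXnM ltnNge leq_addr /= addKn => <-.
by rewrite coef_poly ltnNge (leq_trans (leqnSn _) (leq_addr _ _)).
Qed.

Definition inZq x := exists p, x = evalq qq p.

Lemma inZq_nat (b : bool) : inZq b%:R.
Proof.
exists (if b then 1 else 0); rewrite /evalq; case: b; first by rewrite (rmorph1 (map_poly (intr : int -> Qq))) hornerC.
by rewrite map_poly0 horner0.
Qed.

Lemma inZqD x y : inZq x -> inZq y -> inZq (x + y).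
Proof. by move=> [p ->] [r ->]; exists (p + r); rewrite evalqD. Qed.

Lemma inZq_q x : inqZq x -> inZq x.
Proof. by move=> [p ->]; exists ('X^1 * p); rewrite evalqXM expr1. Qed.

Lemma inqZqD x y : inqZq x -> inqZq y -> inqZq (x + y).
Proof.
move=> [p ->] [r ->]; exists (p + r).
by rewrite -/(evalq qq p) -/(evalq qq r) -/(evalq qq (p + r)) evalqD mulrDr.
Qed.

Lemma inqZqN x : inqZq x -> inqZq (- x).
Proof.
by move=> [p ->]; exists (- p); rewrite -/(evalq qq p) -/(evalq qq (- p)) evalqN mulrN.
Qed.

Lemma inqZq0 : inqZq 0.
Proof. by exists 0; rewrite map_poly0 horner0 mulr0. Qed.

Lemma inqZqM x : inZq x -> inqZq (qq * x).
Proof. by move=> [p ->]; exists p. Qed.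

End Scalars.

Section Uniq.
Variables m n : nat.
Implicit Types (f g h : key m n) (i j k l : 'I_(m + n)) (u v : vec m n).

Variables (barF : {rmorphism Qq -> Qq}) (psi : vec m n -> vec m n).
Hypothesis bq : barF qq = qq^-1.
Hypothesis B : is_bar_involution barF psi.

Lemma bar_expand s v : all (@inZplus m n) s -> uniq s -> (forall g, g \notin s -> v g = 0) ->
  forall g, psi v g = \sum_(h <- s) barF (v h) * psi (Kvec h) g.
Proof.
have [bA bS _ _ _ _ _ _ _] := B.
elim: s v => [|h s IH] v /= => [_ _ v0 g|/andP[hd sd] /andP[hs us] v0 g].
  have -> : v = scalev 0 v by apply: functional_extensionality => g'; rewrite /scalev mul0r v0.
  rewrite bS; last by exists [::].
  by rewrite big_nil /scalev rmorph0 mul0r.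
pose v' : vec m n := fun g => if g == h then 0 else v g.
have v'0 g' : g' \notin s -> v' g' = 0.
  by rewrite /v' => gs; case: eqVneq => // gh; apply: v0; rewrite inE negb_or gh.
have ev : v = addv (scalev (v h) (Kvec h)) v'.
  apply: functional_extensionality => g'; rewrite /addv /scalev /Kvec /v'.
  by case: eqVneq => [->|]; rewrite ?mulr1 ?addr0 ?mulr0 ?add0r.
have iK : isvec (Kvec h) by exact: Kvec_isvec.
rewrite {1}ev bA; [|exact: scalev_isvec|by exists s].
rewrite bS // big_cons /addv /scalev (IH v') //; congr (_ + _).
apply: eq_big_seq => h' hs'; rewrite /v'; case: eqVneq => // e.
by rewrite -e hs' in hs.
Qed.

Lemma seq_argmin (T : eqType) (phi : T -> int) (s : seq T) x0 : x0 \in s ->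
  exists2 x, x \in s & forall y, y \in s -> phi x <= phi y.
Proof.
elim: s x0 => // a [|b s] IH x0 _.
  by exists a; rewrite ?mem_head // => y; rewrite inE => /eqP ->.
have [x xs xm] := IH b (mem_head _ _).
case: (leP (phi a) (phi x)) => ax.
  exists a; rewrite ?mem_head // => y; rewrite inE => /orP[/eqP -> //|/xm].
  exact: le_trans.
exists x; first by rewrite inE xs orbT.
by move=> y; rewrite inE => /orP[/eqP -> |/xm //]; exact: ltW.
Qed.

(** At a key [h] of least height in the support, triangularity leaves only the contribution of
    [Kvec h]. So [v h] is a bar invariant element of q Z[q], hence 0. *)
Lemma bar_invariant_eq0 v : isvec v -> psi v = v -> (forall g, inqZq (v g)) -> forall g, v g = 0.
Proof.
case=> s0 [sd0 v0] iv qv g; apply/eqP/negPn/negP => vg.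
pose s := undup s0.
have sd : all (@inZplus m n) s by apply/allP => x; rewrite mem_undup => /(allP sd0).
have us : uniq s := undup_uniq _.
have sv x : x \notin s -> v x = 0 by rewrite mem_undup; exact: v0.
have gs : g \in [seq h <- s | v h != 0].
  by rewrite mem_filter vg /=; apply: contraNT vg => /sv ->.
have [h] := seq_argmin (@height m n) gs.
rewrite mem_filter => /andP[vh hs] hmin.
have [_ _ _ _ _ _ _ _ bT] := B.
have [b1 _] := bT h (allP sd _ hs).
have := bar_expand sd us sv h; rewrite iv (bigD1_seq h) //= b1 mulr1 big_seq_cond big1 ?addr0; last first.
  move=> h' /andP[hs' hh']; case: (eqVneq (v h') 0) => [->|vh']; first by rewrite rmorph0 mul0r.
  have [_ bT'] := bT h' (allP sd _ hs').
  have [|_ lt] := bT' h; first by rewrite eq_sym.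
  apply/eqP; rewrite mulf_eq0; apply/orP; right; apply/negPn/negP => /lt[_ /bruhat_height].
  by rewrite ltNge hmin // mem_filter vh'.
by move/esym/(bar_inqZq bq (qv h))/eqP; rewrite (negbTE vh).
Qed.

Lemma cupvec_coef f cs h : inqZq (cupvec f cs h - Kvec (sortplus f) h).
Proof.
elim: cs f => [|p cs IH] f /=; first by rewrite subrr; exact: inqZq0.
rewrite /addv /scalev addrAC; apply: inqZqD => //; apply: inqZqM.
rewrite -[X in inZq X](subrK (Kvec (sortplus (swap f p.1 p.2)) h)).
by apply: inZqD; [exact/inZq_q | exact: inZq_nat].
Qed.

Lemma canonical_isvec U f : is_canonical_basis psi U -> inZplus f -> isvec (U f).
Proof.
move=> CB fd; have [_ [_ Ug]] := CB f fd.
(* A key below [f] takes its entries from those of [f], so it is [f] composed with a self-map of the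
   positions, and there are finitely many of these. *)
pose perms := [seq [ffun k => f (s k)] | s : {ffun 'I_(m + n) -> 'I_(m + n)}] : seq (key m n).
exists [seq g <- perms | inZplus g]; split; first exact: filter_all.
move=> g gs; apply/eqP/negPn/negP => ug.
case: (eqVneq g f) => [gf|gf].
  case/negP: gs; rewrite mem_filter gf fd; apply/mapP; exists [ffun k => k]; rewrite ?mem_enum //.
  by apply/ffunP => k; rewrite !ffunE.
have [gd lt] := (Ug g gf).2 ug.
case/negP: gs; rewrite mem_filter gd /=.
have H k : exists l, f l == g k.
  apply/existsP; rewrite -[X in is_true X]negbK; apply/negP => /existsPn H.
  have := bruhat_mult (g k) lt; rewrite /mult (bigD1 k) //= eqxx [RHS]big1 //.
  by move=> l _; apply/eqP; rewrite eqb0 H.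
apply/mapP; exists [ffun k => xchoose (H k)]; rewrite ?mem_enum //.
by apply/ffunP => k; rewrite !ffunE; apply/esym/eqP/(xchooseP (H k)).
Qed.

(** Both sides are bar invariant and differ from [Kvec (sortplus f)] by coefficients in q Z[q], so
    [bar_invariant_eq0] applies to their difference. *)
Lemma canonical_cupvec U f : is_canonical_basis psi U -> sinj f ->
  U (sortplus f) = cupvec f (cups f).
Proof.
move=> CB fi; have [bA bS _ _ _ _ _ _ _] := B.
have hd := sortplus_inZplus fi; have [Up [U1 Ug]] := CB _ hd.
have ne := nested_cups_of fi.
have [ok _] := nested_cups fi (fun k (H : lone f k) => H) ne.
have Ui := canonical_isvec CB hd; have Wi := cupvec_isvec ok.
set W := cupvec _ _ in Wi *.
suff H g : addv (U (sortplus f)) (scalev (-1) W) g = 0.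
  apply: functional_extensionality => g; have := H g; rewrite /addv /scalev mulN1r.
  by move/eqP; rewrite subr_eq0 => /eqP.
apply: bar_invariant_eq0; first by apply: addv_isvec => //; exact: scalev_isvec.
  by rewrite bA //; [rewrite bS // Up (bar_cupvec B) // rmorphN1 | exact: scalev_isvec].
move=> h; rewrite /addv /scalev mulN1r.
rewrite -(subrKA (Kvec (sortplus f) h)); apply: inqZqD.
  rewrite /Kvec; case: eqVneq => [->|hf]; first by rewrite U1 subrr; exact: inqZq0.
  by rewrite subr0; case: (Ug h hf).
by rewrite -opprB; apply/inqZqN/cupvec_coef.
Qed.

End Uniq.

(** * Expansion along particles *)

Section FoldSum.
Variables (R : comPzRingType) (I C : finType) (O : Type).
Variables (step : I -> C -> O -> O) (wt : C -> R) (c0 : C).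
Implicit Types (H : O -> R) (s : seq I).

(** The sum over all exponent functions, taken one coordinate at a time. *)
Fixpoint foldsum H o s : R :=
  if s is i :: s' then \sum_c wt c * foldsum H (step i c o) s' else H o.

Lemma foldsum_rcons H o s i :
  foldsum H o (rcons s i) = foldsum (fun o => \sum_c wt c * H (step i c o)) o s.
Proof. by elim: s o => //= j s IH o; apply: eq_bigr => c _; rewrite IH. Qed.

Lemma eq_foldsum H H' o s : H =1 H' -> foldsum H o s = foldsum H' o s.
Proof. by move=> e; elim: s o => //= j s IH o; apply: eq_bigr => c _; rewrite IH. Qed.

(** Functions with the default value [c0] outside [s]; they allow induction on [s]. *)
Let supp s (t : {ffun I -> C}) := [forall i, (i \notin s) ==> (t i == c0)].
Let upd i c (t : {ffun I -> C}) : {ffun I -> C} := [ffun k => if k == i then c else t k].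

Lemma sum_foldl_supp H o s : uniq s ->
  \sum_(t | supp s t) (\prod_(i <- s) wt (t i)) * H (foldl (fun o i => step i (t i) o) o s) =
  foldsum H o s.
Proof.
elim: s o => [|i s IH] o /=.
  move=> _; rewrite (big_pred1 [ffun=> c0]) ?big_nil ?mul1r // => t.
  apply/forallP/eqP => [h|-> i]; last by rewrite ffunE eqxx implybT.
  by apply/ffunP => i; rewrite ffunE; apply/eqP; have := h i.
case/andP => nis us; rewrite (partition_big (fun t : {ffun I -> C} => t i) predT) //=.
apply: eq_bigr => c _; rewrite -IH // mulr_sumr.
(* The functions with value [c] at [i] correspond to those supported on [s], by resetting the value
   at [i] to [c0]. *)
rewrite (reindex_onto (upd i c) (upd i c0)); last first.
  move=> t /andP[_ /eqP tc]; apply/ffunP => k; rewrite !ffunE.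
  by case: (eqVneq k i) => // ->.
apply: eq_big => [t|t _].
  apply/idP/idP.
    case/andP => /andP[/forallP h _] /eqP e; apply/forallP => k; apply/implyP => ks.
    rewrite -e !ffunE; case: (eqVneq k i) => [_|ki]; first by rewrite eqxx.
    by have := h k; rewrite inE negb_or ki ks !ffunE (negbTE ki).
  move/forallP => h; rewrite ffunE eqxx eqxx andbT; apply/andP; split.
    apply/forallP => k; apply/implyP; rewrite inE negb_or => /andP[ki ks].
    by rewrite ffunE (negbTE ki); have := h k; rewrite ks.
  apply/eqP/ffunP => k; rewrite !ffunE; case: (eqVneq k i) => // ->.
  by apply/esym/eqP; have := h i; rewrite nis.
have ek k : k \in s -> upd i c t k = t k.
  by move=> ks; rewrite ffunE; case: (eqVneq k i) => // e; rewrite -e ks in nis.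
rewrite big_cons {1 3}/upd !ffunE eqxx -mulrA; congr (_ * (_ * _)).
  by apply: eq_big_seq => k /ek ->.
congr H; elim: s (step i c o) {IH us nis} ek => //= k s IHs o' ek.
rewrite ek ?mem_head // IHs // => l ls; apply: ek; by rewrite inE ls orbT.
Qed.

Lemma sum_foldl H o s : perm_eq s (enum I) ->
  \sum_(t : {ffun I -> C}) (\prod_i wt (t i)) * H (foldl (fun o i => step i (t i) o) o s) =
  foldsum H o s.
Proof.
move=> e; have us : uniq s by rewrite (perm_uniq e) enum_uniq.
rewrite -sum_foldl_supp //; apply: eq_big => [t|t _].
  by apply/esym/forallP => i; rewrite (perm_mem e) mem_enum.
by congr (_ * _); rewrite [RHS](perm_big _ e) big_enum.
Qed.

End FoldSum.

(** * Applying the operators one particle at a time *)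

Section Main.
Variables m n : nat.
Implicit Types (f g h : key m n) (i k l : 'I_m) (o : option (key m n)) (s : seq 'I_m).

Definition emb i : 'I_(m + n) := widen_ord (leq_addr n m) i.

Lemma isneg_emb i : isneg (emb i).
Proof. by rewrite /isneg /=. Qed.
Lemma emb_inj : injective emb.
Proof. by move=> i k /(congr1 val) /= e; apply: val_inj. Qed.

Lemma LopE i f : Lop i f = omap (swap f (emb i)) (partner f (emb i)).
Proof. by rewrite /Lop /partner; case: pickP. Qed.

(** The expanded product of the factors 1 + q L_i. The head of [s] acts first, and sorting is
    postponed to the end. *)
Fixpoint expand o s : vec m n :=
  if s is i :: s' then addv (expand o s') (scalev qq (expand (obind (@Lop m n i) o) s'))
  else Kopt (omap (@sortplus m n) o).

Lemma expand_None s g : expand None s g = 0.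
Proof. by elim: s => //= i s IH; rewrite /addv /scalev IH mulr0 addr0. Qed.

Definition cups_from g s :=
  pmap (fun i => omap (pair (emb i)) (partner g (emb i))) s.

Definition unshadowed g s := pairwise (fun k l => ~~ shadow g (emb l) (g (emb k))) s.

(** By [flip_shadow], flipping the head changes neither the partner nor the shadow of a later
    particle, so each operator flips a cup of the original key. *)
Lemma expand_cups g s : sinj g -> uniq s -> unshadowed g s ->
  expand (Some g) s = cupvec g (cups_from g s).
Proof.
elim: s g => //= i s IH g gi /andP[nis us] /andP[/allP hi hs].
rewrite LopE IH //; case: (partnerP (emb i) gi) => [[j M ->]|[-> _]] /=; last first.
  apply: functional_extensionality => h.
  by rewrite /addv /scalev expand_None mulr0 addr0.
have := inSigma_atyp M; rewrite atypE // => /and5P[_ nj _ li lj].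
set g' := swap g (emb i) j.
have g'i : sinj g' by exact: sinj_swap.
have F l : l \in s -> [/\ g' (emb l) = g (emb l), partner g' (emb l) = partner g (emb l)
                        & shadow g' (emb l) =1 shadow g (emb l)].
  move=> ls; have li' : emb l != emb i by rewrite (inj_eq emb_inj); apply: contraNneq nis => <-.
  have [_ e1 e2] := flip_shadow gi M (isneg_emb l) li' (hi l ls).
  by split=> //; apply: swap_id => //; apply: contraNneq nj => <-; apply: isneg_emb.
rewrite -/(cups_from g s) IH //; last first.
  move: hs; rewrite /unshadowed.
  elim: s F {IH nis us hi} => //= k s IHs F /andP[/allP h1 h2].
  have [ek _ _] := F k (mem_head _ _).
  rewrite IHs // ?andbT; last by move=> l ls; apply: F; rewrite inE ls orbT.
  apply/allP => l ls; have ls' : l \in k :: s by rewrite inE ls orbT.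
  by have [_ _ el] := F l ls'; rewrite el ek; apply: h1.
have -> // : cups_from g' s = cups_from g s.
rewrite /cups_from; elim: s F {IH nis us hi hs} => //= k s IHs F.
have [_ -> _] := F k (mem_head _ _); rewrite IHs // => l ls.
by apply: F; rewrite inE ls orbT.
Qed.

(** Each cup has exactly one negative end, so listing by particles meets every cup once. *)
Lemma cups_from_enum g : sinj g -> perm_eq (cups g) (cups_from g (enum 'I_m)).
Proof.
move=> gi; apply: uniq_perm; first exact: sigma_uniq.
  have : uniq (enum 'I_m) by exact: enum_uniq.
  elim: (enum 'I_m) => //= i s IH /andP[nis us].
  case: (partner g (emb i)) => [j|] /=; last exact: IH.
  rewrite -/(cups_from g s) IH // andbT mem_pmap.
  apply/mapP => -[k ks]; case: (partner g (emb k)) => //= j'.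
  by move/(congr1 (oapp fst (emb i)))/emb_inj => /= e; rewrite e ks in nis.
move=> p; rewrite mem_cups mem_pmap; apply/idP/mapP => [M|[i _]].
  have pm : (p.1 < m)%N by have /and5P[] := inSigma_atyp M.
  have e : emb (Ordinal pm) = p.1 by apply: val_inj.
  exists (Ordinal pm); first by rewrite mem_enum.
  by rewrite e (eqP (etrans (partner_some _ _ gi) M)) /=; case: (p).
case: (partnerP (emb i) gi) => [[j M ->]|[-> _]] //= [->].
exact: M.
Qed.

Lemma expand_canonical (barF : {rmorphism Qq -> Qq}) psi U g : barF qq = qq^-1 -> @is_bar_involution m n barF psi ->
  is_canonical_basis psi U -> sinj g -> unshadowed g (enum 'I_m) ->
  expand (Some g) (enum 'I_m) = U (sortplus g).
Proof.
move=> bq B CB gi gs; rewrite expand_cups ?enum_uniq // (canonical_cupvec bq B CB gi).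
apply/esym/cupvec_perm; first exact: cups_from_enum.
by have [] := nested_cups gi (fun z (H : lone g z) => H) (nested_cups_of gi).
Qed.

(* The particles of index below [t] are those that have not moved yet. *)
Definition settled (t : nat) g := sinj g /\ forall k l, (k < l)%N ->
  ~~ shadow g (emb l) (g (emb k)) /\ ((k < t)%N -> g (emb l) < g (emb k)).

(** Particles before [i] stay to the right of all later ones, because the move lowers the entry of
    [i]. For later particles, [flip_shadow] keeps their shadows and keeps [i] outside them. *)
Lemma settled_step i g g' : settled i g -> Lop i g = Some g' -> settled i g'.
Proof.
case=> gi H; rewrite LopE; case: (partnerP (emb i) gi) => [[j M ->]|[-> //]] [<-].
have := inSigma_atyp M; rewrite atypE // => /and5P[_ nj lt lo lj].
split; first exact: sinj_swap.
have nj' k : emb k != j by apply: contraNneq nj => <-; apply: isneg_emb.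
have sw k : k != i -> swap g (emb i) j (emb k) = g (emb k).
  by move=> ki; rewrite swap_id // (inj_eq emb_inj).
move=> k l kl; case: (ltnP k i) => ki.
  have nki : k != i by apply: contraTneq ki => ->; rewrite ltnn.
  suff L : swap g (emb i) j (emb l) < swap g (emb i) j (emb k).
    by split=> //; rewrite /shadow leNgt L.
  rewrite (sw k) //; case: (eqVneq l i) => [->|li].
    by rewrite swapL; apply: lt_trans lt _; have [_ ->] := H k i ki.
  by rewrite sw //; have [_ ->] := H k l kl.
split=> //; have il : (i < l)%N by apply: leq_ltn_trans kl.
have li : l != i by apply: contraTneq il => ->; rewrite ltnn.
have [hi _] := H i l il.
have [s1 _ s2] := flip_shadow gi M (isneg_emb l) (etrans (congr1 negb (inj_eq emb_inj _ _)) li) hi.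
rewrite s2; case: (eqVneq k i) => [->|nki]; first by rewrite swapL.
by rewrite sw //; have [] := H k l kl.
Qed.

Lemma iter_None r i : iter r (obind (@Lop m n i)) None = None.
Proof. by elim: r => //= r ->. Qed.

Lemma foldl_None (w : 'I_m -> nat) s :
  foldl (fun o i => iter (w i) (obind (@Lop m n i)) o) None s = None.
Proof. by elim: s => //= i s; rewrite iter_None. Qed.

Lemma settled_foldl (w : 'I_m -> nat) t g g' s :
  settled t g -> path (fun x y : nat => (y < x)%N) t (map val s) ->
  foldl (fun o i => iter (w i) (obind (@Lop m n i)) o) (Some g) s = Some g' -> settled 0 g'.
Proof.
have weak t1 t2 h : (t1 <= t2)%N -> settled t2 h -> settled t1 h.
  move=> t12 [hi H]; split=> // k l kl; have [h1 h2] := H k l kl; split=> // kt.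
  by apply: h2; apply: leq_trans t12.
elim: s t g => [|i s IH] t g /= gt.
  by move=> _ [<-]; apply: weak gt.
case/andP => it pt.
have : forall r, match iter r (obind (@Lop m n i)) (Some g) with
                 | Some h => settled i h | None => True end.
  elim=> [|r] /=; first by apply: weak gt; apply: ltnW.
  case: (iter r _ _) => //= h ih; case E: (Lop i h) => [h'|] //.
  exact: settled_step E.
move/(_ (w i)); case: (iter _ _ _) => [h hi|_]; last by rewrite foldl_None.
exact: IH pt.
Qed.

Lemma path_rev_enum : path (fun x y : nat => (y < x)%N) m (map val (rev (enum 'I_m))).
Proof.
rewrite map_rev val_enum_ord; elim: (m) => // r IH.
by rewrite -addn1 iotaD rev_cat /= add0n addn1 ltnSn.
Qed.

Lemma settled_dominant f : inZplus f -> settled m f.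
Proof.
move=> fd; split; first exact: inZplus_sinj.
move=> k l kl; have L : f (emb l) < f (emb k).
  by move/inZplusP: fd; apply; rewrite ?isneg_emb.
by split=> //; rewrite /shadow leNgt L.
Qed.

Lemma settled_unshadowed t g : settled t g -> unshadowed g (enum 'I_m).
Proof.
case=> _ H; have : pairwise (fun k l : 'I_m => (k < l)%N) (enum 'I_m).
  rewrite -(pairwise_map (fun i : 'I_m => val i) ltn) val_enum_ord.
  by rewrite -sorted_pairwise ?iota_ltn_sorted //; apply: ltn_trans.
by apply: sub_pairwise => k l /H [].
Qed.

Definition below g i := #|[set k | g k < g (emb i)]|.

(** Each application of [Lop i] lowers the particle, hence strictly reduces the number of smaller
    entries. Powers beyond [m + n] therefore vanish, and the sum over exponents is finite. *)
Lemma below_iter r i f g : iter r (obind (@Lop m n i)) (Some f) = Some g ->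
  (below g i + r <= m + n)%N.
Proof.
elim: r g => [|r IH] g /=.
  by move=> [<-]; rewrite addn0 -[X in (_ <= X)%N]card_ord; apply: max_card.
case: (iter r _ _) IH => //= h /(_ h erefl) hr; rewrite LopE /partner.
case: pickP => // j M [<-]; have /and5P[_ _ lt _ _] := inSigma_atyp M.
suff : (below (swap h (emb i) j) i < below h i)%N by lia.
rewrite /below swapL -(card_imset _ (@perm_inj _ (tperm (emb i) j))).
apply: proper_card; apply/properP; split.
  apply/subsetP => k /imsetP[k']; rewrite !inE swapE => L ->.
  exact: lt_trans L lt.
exists j; first by rewrite inE.
by apply/imsetP => -[k']; rewrite inE swapE => L e; rewrite -e ltxx in L.
Qed.

Lemma iter_Lop_None i o : iter (m + n).+1 (obind (@Lop m n i)) o = None.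
Proof.
case: o => [f|]; last exact: iter_None.
case E: (iter _ _ _) => [g|] //; have := below_iter E; lia.
Qed.

(** The second summand of [expand] at power [r] cancels the first one at power [r + 1]. *)
Lemma expand_telescope i o s g :
  \sum_(r < (m + n).+1) (- qq) ^+ r * expand (iter r (obind (@Lop m n i)) o) (i :: s) g =
  expand o s g.
Proof.
have H K : \sum_(r < K) (- qq) ^+ r * expand (iter r (obind (@Lop m n i)) o) (i :: s) g =
    expand o s g - (- qq) ^+ K * expand (iter K (obind (@Lop m n i)) o) s g.
  elim: K => [|K IH]; first by rewrite big_ord0 mul1r subrr.
  rewrite big_ord_recr IH /= {1}/addv {1}/scalev mulrDr addrA subrK.
  by rewrite exprSr mulrN mulNr opprK mulrA.
by rewrite H iter_Lop_None expand_None mulr0 subr0.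
Qed.

(** The operator applied last by the reversed list is the first factor of [expand], so the innermost
    sum telescopes and induction removes the others. *)
Lemma foldsum_telescope o s g :
  foldsum (fun i (c : 'I_(m + n).+1) o => iter c (obind (@Lop m n i)) o)
    (fun c => (- qq) ^+ c) (fun o => expand o s g) o (rev s) =
  Kopt (omap (@sortplus m n) o) g.
Proof.
elim: s o => // i s IH o; rewrite rev_cons foldsum_rcons -IH.
by apply: eq_foldsum => o'; apply: expand_telescope.
Qed.

Lemma foldsum_expand o s g :
  foldsum (fun i (c : bool) o => iter c (obind (@Lop m n i)) o) (fun c => qq ^+ c)
    (fun o => Kopt (omap (@sortplus m n) o) g) o s = expand o s g.
Proof.
elim: s o => // i s IH o /=; rewrite big_bool /= !IH /addv /scalev mul1r.
by rewrite addrC.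
Qed.

End Main.

Theorem theorem4p25 (m n : nat) (barF : {rmorphism Qq -> Qq})
    (psi : vec m n -> vec m n) (U : key m n -> vec m n) (f : key m n) :
  barF qq = qq^-1 ->
  is_bar_involution barF psi ->
  is_canonical_basis psi U ->
  inZplus f ->
  (forall g : key m n,
     U f g = \sum_(theta : {ffun 'I_m -> bool})
               qq ^+ (\sum_(i < m) (theta i : nat))%N
               * Kopt (Ltheta (fun i => (theta i : nat)) f) g)
  /\
  (exists s : seq {ffun 'I_m -> nat},
     [/\ uniq s,
         forall theta : {ffun 'I_m -> nat}, (Ltheta' theta f != None) = (theta \in s)
       & forall g : key m n,
           Kvec f g = \sum_(theta <- s)
                        (- qq) ^+ (\sum_(i < m) theta i)%N
                        * Uopt U (Ltheta' theta f) g]).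
Proof.
move=> bq B CB fd; have fi := inZplus_sinj fd; have fs := settled_dominant fd.
split.
  move=> g; rewrite -{1}(sortplus_id fd) -(expand_canonical bq B CB fi (settled_unshadowed fs)).
  rewrite -foldsum_expand -(sum_foldl _ _ false) //.
  by apply: eq_bigr => t _; rewrite prodrXr.
pose T := {ffun 'I_m -> 'I_(m + n).+1}.
pose nt (t : T) : {ffun 'I_m -> nat} := [ffun i => t i : nat].
have nt_inj : injective nt.
  by move=> t t' /ffunP e; apply/ffunP => i; apply: val_inj; have := e i; rewrite !ffunE.
pose raw (t : 'I_m -> nat) := foldl (fun o i => iter (t i) (obind (@Lop m n i)) o) (Some f) (rev (enum 'I_m)).
have rawE t : Ltheta' t f = omap (@sortplus m n) (raw t) by [].
exists [seq th : {ffun 'I_m -> nat} <- map nt (enum {: T}) | Ltheta' th f != None]; split.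
- by rewrite filter_uniq // map_inj_uniq // enum_uniq.
- move=> th; rewrite mem_filter; case: (boolP (Ltheta' th f != None)) => //= H; apply/esym.
  (* A larger exponent would give [None] at the factor [i], and [None] is kept by all later
     operators. *)
  have bnd i : (th i < (m + n).+1)%N.
    rewrite ltnNge; apply: contra H => le; rewrite rawE /raw.
    have : i \in rev (enum 'I_m) by rewrite mem_rev mem_enum.
    elim: (rev _) (Some f) => //= j s IH o; rewrite inE => /orP[/eqP <-|/IH -> //].
    by rewrite -(subnK le) iterD iter_Lop_None iter_None foldl_None.
  apply/mapP; exists [ffun i => Ordinal (bnd i)]; rewrite ?mem_enum //.
  by apply/ffunP => i; rewrite !ffunE.
move=> g; have -> : Kvec f g = Kopt (omap (@sortplus m n) (Some f)) g by rewrite /= sortplus_id.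
rewrite -(foldsum_telescope _ (enum 'I_m)) -(sum_foldl _ _ ord0); last by rewrite perm_rev.
rewrite big_filter big_map big_enum_cond [RHS]big_mkcond; apply: eq_bigr => t _.
have nE : (nt t : 'I_m -> nat) = (fun i => t i : nat).
  by apply: functional_extensionality => i; rewrite ffunE.
rewrite prodrXr rawE /= nE -/(raw _); case E: (raw _) => [h|] /=; last by rewrite expand_None mulr0.
(* Every key that contributes is settled, so its canonical basis element is the expanded product. *)
have hs := settled_foldl fs (path_rev_enum m) E; have hi : sinj h by case: hs.
by rewrite (expand_canonical bq B CB hi (settled_unshadowed hs)).
Qed.
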